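(* Let $R$ be an almost perfect domain with field of quotients $Q\neq R$. An $R$-module $M$ is flat if and only if $M$ is torsion-free and $\mathrm{p.d.}_R(M)\le 1$; that is, $\mathcal{FL}=\mathcal{TF}\cap\mathcal{P}_1=\mathcal{TF}\cap\mathcal{F}_1$.
   Context: All rings are commutative with $1\neq 0$ and all modules are unital. A ring is perfect if every module over it has a projective cover. An almost perfect domain is an integral domain $R$ such that $R/I$ is perfect for every non-zero proper ideal $I$. $\mathrm{p.d.}_R(M)$ is the projective dimension of $M$. $\mathcal{FL}$, $\mathcal{TF}$, $\mathcal{P}_1$, $\mathcal{F}_1$ denote the classes of $R$-modules that are, respectively, flat, torsion-free, of projective dimension at most $1$, and of weak (flat) dimension at most $1$. *)

(* Defs.v *)
(* Under the classical axioms of mathcomp.classical.boolp every subset is a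
   boolean predicate and every type has a choice structure, so that idealr,
   submodClosed and lmodType range over all ideals, submodules and modules. *)
From HB Require Import structures.
From mathcomp Require Import all_boot all_algebra.
From mathcomp Require Import generic_quotient ring_quotient fraction.
From mathcomp Require Import boolp.
From mathcomp.multinomials Require Import freeg.

Set Implicit Arguments.
Unset Strict Implicit.
Unset Printing Implicit Defensive.

Import GRing.Theory.
Local Open Scope ring_scope.
Local Open Scope quotient_scope.

Definition surjective (A B : Type) (f : A -> B) : Prop :=
  forall y, exists x, f x = y.

Definition exact_at (R : nzRingType) (A B C : lmodType R)
    (f : {linear A -> B}) (g : {linear B -> C}) : Prop :=
  forall y, g y = 0 <-> exists x, f x = y.

Section Span.
Variables (R : nzRingType) (V : lmodType R) (G : V -> Prop).

Definition span : {pred V} := fun x =>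
  `[< forall N : submodClosed V, (forall g, G g -> g \in N) -> x \in N >].

Lemma span_submod_closed : submod_closed span.
Proof.
split=> [|a u v /asboolP uS /asboolP vS]; apply/asboolP => N GN.
  exact: rpred0.
by rewrite rpredD ?rpredZ ?uS ?vS.
Qed.

HB.instance Definition _ := GRing.isSubmodClosed.Build R V span
  span_submod_closed.

Definition span_submod : submodClosed V := GRing.SubmodClosed.clone R V span _.

Lemma mem_span g : G g -> g \in span.
Proof. by move=> Gg; apply/asboolP => N; apply. Qed.

End Span.

Section QuotientModule.
Variables (R : nzRingType) (V : lmodType R) (S : submodClosed V).

(* submodClosed does not inherit from zmodClosed, which Quotient.quot expects. *)
Definition submod_pred : V -> bool := mem S.

Lemma submod_pred_zmod_closed : zmod_closed submod_pred.
Proof. exact: GRing.submod_closedB (submodClosedP S). Qed.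

HB.instance Definition _ := GRing.isZmodClosed.Build V submod_pred
  submod_pred_zmod_closed.

Definition submod_zmod : zmodClosed V :=
  GRing.ZmodClosed.clone V submod_pred _.

Definition quotmod := Quotient.quot submod_zmod.
HB.instance Definition _ := EqQuotient.on quotmod.
HB.instance Definition _ := GRing.Zmodule.on quotmod.

Definition quotmod_pi (x : V) : quotmod := \pi_quotmod x.

Lemma quotmod_piP x y : quotmod_pi x = quotmod_pi y <-> x - y \in S.
Proof.
have -> : x - y \in S = (quotmod_pi x == quotmod_pi y).
  exact: (Quotient.idealrBE submod_zmod).
by split => /eqP.
Qed.

Lemma quotmod_reprK (x : quotmod) : quotmod_pi (repr x) = x.
Proof. exact: reprK. Qed.

Lemma quotmod_piD : {morph quotmod_pi : x y / x + y}.
Proof. exact: raddfD. Qed.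

Definition quotmod_scale (a : R) (x : quotmod) : quotmod :=
  quotmod_pi (a *: repr x).

Lemma quotmod_piZ a x : quotmod_pi (a *: x) = quotmod_scale a (quotmod_pi x).
Proof.
by apply/quotmod_piP; rewrite -scalerBr rpredZ//; apply/quotmod_piP;
   rewrite quotmod_reprK.
Qed.

Lemma quotmod_scaleA a b x :
  quotmod_scale a (quotmod_scale b x) = quotmod_scale (a * b) x.
Proof. by rewrite -[x]quotmod_reprK -!quotmod_piZ scalerA. Qed.

Lemma quotmod_scale1 : left_id 1 quotmod_scale.
Proof. by move=> x; rewrite -[x]quotmod_reprK -!quotmod_piZ scale1r. Qed.

Lemma quotmod_scaleDr : right_distributive quotmod_scale +%R.
Proof.
move=> a x y; rewrite -[x]quotmod_reprK -[y]quotmod_reprK.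
by rewrite -!(quotmod_piD, quotmod_piZ) scalerDr.
Qed.

Lemma quotmod_scaleDl x : {morph quotmod_scale^~ x : a b / a + b}.
Proof.
move=> a b; rewrite -[x]quotmod_reprK.
by rewrite -!(quotmod_piZ, quotmod_piD) scalerDl.
Qed.

HB.instance Definition _ := GRing.Zmodule_isLmodule.Build R quotmod
  quotmod_scaleA quotmod_scale1 quotmod_scaleDr quotmod_scaleDl.

Lemma quotmod_pi_is_linear : linear quotmod_pi.
Proof. by move=> a x y; rewrite quotmod_piD quotmod_piZ. Qed.

HB.instance Definition _ := GRing.isLinear.Build R V quotmod _ quotmod_pi
  quotmod_pi_is_linear.

End QuotientModule.

Section FreeLift.
Variables (R : nzRingType) (K : choiceType) (C : lmodType R) (f : K -> C).

Lemma fglift_is_linear : linear (fglift f).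
Proof.
pose fa := GRing.isZmodMorphism.Build {freeg K / R} C _ (lift_is_additive f).
pose l : {additive {freeg K / R} -> C} := HB.pack (fglift f) fa.
have l0 : fglift f 0 = 0 := raddf0 l.
have lD u v : fglift f (u + v) = fglift f u + fglift f v := raddfD l u v.
move=> r x y; rewrite lD; congr (_ + _).
elim/freeg_ind_dom0: x => [|k p D _ _ IH].
  by rewrite scaler0 l0 scaler0.
have -> : r *: (<< k *g p >> + D) = << (r * k) *g p >> + r *: D.
  rewrite scalerDr; congr (_ + _).
  by apply/eqP/freeg_eqP => z; rewrite coeffZ !coeffU mulrA.
by rewrite !lD IH !liftU scalerDr scalerA.
Qed.

HB.instance Definition _ := GRing.isLinear.Build R {freeg K / R} C _ (fglift f)
  fglift_is_linear.

End FreeLift.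

Section Tensor.
Variables (R : comNzRingType) (A B : lmodType R).

Local Notation F := {freeg (A * B) / R}.
Local Notation gen a b := (<< (a, b) >> : F).

Variant bilinear_relation : F -> Prop :=
| RelDl a a' b : bilinear_relation (gen (a + a') b - (gen a b + gen a' b))
| RelDr a b b' : bilinear_relation (gen a (b + b') - (gen a b + gen a b'))
| RelZl r a b : bilinear_relation (gen (r *: a) b - r *: gen a b)
| RelZr r a b : bilinear_relation (gen a (r *: b) - r *: gen a b).

Definition tensor := quotmod (span_submod bilinear_relation).
HB.instance Definition _ := GRing.Lmodule.on tensor.

Definition pure (a : A) (b : B) : tensor :=
  quotmod_pi (span_submod bilinear_relation) (gen a b).

(* Meaningful only for bilinear h; tensor_lift_pure and tensor_lift_is_linear
   then show that it does not depend on the representative. *)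
Definition tensor_lift (C : lmodType R) (h : A -> B -> C) (x : tensor) : C :=
  fglift (fun p => h p.1 p.2) (repr x).

Lemma pureDl a a' b : pure (a + a') b = pure a b + pure a' b.
Proof.
by rewrite /pure -raddfD; apply/quotmod_piP/mem_span; apply: RelDl.
Qed.

Lemma pureDr a b b' : pure a (b + b') = pure a b + pure a b'.
Proof.
by rewrite /pure -raddfD; apply/quotmod_piP/mem_span; apply: RelDr.
Qed.

Lemma pureZl r a b : pure (r *: a) b = r *: pure a b.
Proof.
by rewrite /pure -linearZ; apply/quotmod_piP/mem_span; apply: RelZl.
Qed.

Lemma pureZr r a b : pure a (r *: b) = r *: pure a b.
Proof.
by rewrite /pure -linearZ; apply/quotmod_piP/mem_span; apply: RelZr.
Qed.

Lemma tensor_ind (P : tensor -> Prop) :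
    (forall a b, P (pure a b)) -> (forall x y, P x -> P y -> P (x + y)) ->
    (forall r x, P x -> P (r *: x)) ->
  forall x, P x.
Proof.
move=> Pp PD PZ x; rewrite -[x]quotmod_reprK; move: (repr x) => {x} x.
elim/freeg_ind_dom0: x => [|k [a b] D _ _ PDD].
  by rewrite raddf0 -(scale0r (pure 0 0)); apply: PZ; apply: Pp.
rewrite quotmod_piD; apply: PD => //.
have -> : << k *g (a, b) >> = k *: gen a b.
  by apply/eqP/freeg_eqP => z; rewrite coeffZ !coeffU mul1r.
by rewrite quotmod_piZ; apply: (PZ k (pure a b)); apply: Pp.
Qed.

Definition bilinear_map (C : lmodType R) (h : A -> B -> C) : Prop :=
  (forall b, linear (h^~ b)) /\ (forall a, linear (h a)).

Section Lift.
Variables (C : lmodType R) (h : A -> B -> C) (hP : bilinear_map h).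

Local Notation lift := (fglift (fun p : A * B => h p.1 p.2)).

Lemma fglift_span x : x \in span bilinear_relation -> lift x = 0.
Proof.
pose K : {pred F} := fun x => `[< lift x = 0 >].
have KP : submod_closed K.
  split=> [|r u v /asboolP u0 /asboolP v0]; apply/asboolP; first exact: raddf0.
  by rewrite fglift_is_linear u0 v0 scaler0 addr0.
pose KM := GRing.isSubmodClosed.Build R F K KP.
pose N : submodClosed F := HB.pack K KM.
have [hl hr] := hP.
have lZ r y : lift (r *: y) = r *: lift y.
  have := fglift_is_linear (fun p : A * B => h p.1 p.2) r y 0.
  by rewrite addr0 raddf0 addr0.
have hlD b u v : h (u + v) b = h u b + h v b.
  by have := hl b 1 u v; rewrite !scale1r.
have hrD a u v : h a (u + v) = h a u + h a v.
  by have := hr a 1 u v; rewrite !scale1r.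
have hl0 b : h 0 b = 0.
  by apply: (addrI (h 0 b)); rewrite -hlD !addr0.
have hr0 a : h a 0 = 0.
  by apply: (addrI (h a 0)); rewrite -hrD !addr0.
have hlZ b r u : h (r *: u) b = r *: h u b.
  by have /= := hl b r u 0; rewrite hl0 !addr0.
have hrZ a r u : h a (r *: u) = r *: h a u.
  by have /= := hr a r u 0; rewrite hr0 !addr0.
move=> /asboolP/(_ N) Nx; apply/asboolP/Nx => {Nx} _ [a a' b|a b b'|r a b|r a b];
  apply/asboolP; rewrite raddfB ?raddfD /= ?lZ !liftU !scale1r /=.
- by rewrite hlD -opprD subrr.
- by rewrite hrD -opprD subrr.
- by rewrite hlZ subrr.
- by rewrite hrZ subrr.
Qed.

Lemma tensor_lift_pi x :
  tensor_lift h (quotmod_pi (span_submod bilinear_relation) x) = lift x.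
Proof.
apply/eqP; rewrite -subr_eq0 -raddfB; apply/eqP/fglift_span.
by apply/quotmod_piP; rewrite quotmod_reprK.
Qed.

Lemma tensor_lift_pure a b : tensor_lift h (pure a b) = h a b.
Proof. by rewrite tensor_lift_pi liftU scale1r. Qed.

Lemma tensor_lift_is_linear : linear (tensor_lift h).
Proof.
move=> r x y; rewrite -[x]quotmod_reprK -[y]quotmod_reprK -linearP.
by rewrite !tensor_lift_pi fglift_is_linear.
Qed.

End Lift.

End Tensor.

Section TensorMap.
Variables (R : comNzRingType) (A B : lmodType R) (f : {linear A -> B}).
Variable M : lmodType R.

Definition tensor_map : tensor A M -> tensor B M :=
  tensor_lift (fun a m => pure (f a) m).

Lemma tensor_map_bilinear : bilinear_map (fun a (m : M) => pure (f a) m).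
Proof.
split=> [m r a a'|a r m m'] /=.
  by rewrite linearP pureDl pureZl.
by rewrite pureDr pureZr.
Qed.

Lemma tensor_map_pure a m : tensor_map (pure a m) = pure (f a) m.
Proof. exact: (tensor_lift_pure tensor_map_bilinear). Qed.

HB.instance Definition _ := GRing.isLinear.Build R (tensor A M) (tensor B M) _
  tensor_map (tensor_lift_is_linear tensor_map_bilinear).

End TensorMap.

Definition flat (R : comNzRingType) (M : lmodType R) : Prop :=
  forall (A B : lmodType R) (f : {linear A -> B}),
    injective f -> injective (tensor_map f (M := M)).

Definition projective (R : nzRingType) (P : lmodType R) : Prop :=
  forall (A B : lmodType R) (g : {linear A -> B}) (f : {linear P -> B}),
    surjective g -> exists h : {linear P -> A}, forall x, g (h x) = f x.

Definition torsion_free (R : idomainType) (M : lmodType R) : Prop :=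
  forall (r : R) (x : M), r *: x = 0 -> r = 0 \/ x = 0.

(* There is an exact sequence 0 -> P_n -> ... -> P_0 -> M -> 0 whose terms
   satisfy C; it is extended by zero modules beyond P_n. *)
Definition resolution_dim_le (R : nzRingType) (C : lmodType R -> Prop) (n : nat)
    (M : lmodType R) : Prop :=
  exists (P : nat -> lmodType R) (d : forall i, {linear P i.+1 -> P i})
         (e : {linear P 0 -> M}),
    [/\ forall i, C (P i),
        forall i, (n < i)%N -> forall x : P i, x = 0,
        surjective e,
        exact_at (d 0) e
      & forall i, exact_at (d i.+1) (d i)].

Definition proj_dim_le (R : nzRingType) (n : nat) (M : lmodType R) : Prop :=
  resolution_dim_le (@projective R) n M.

Definition weak_dim_le (R : comNzRingType) (n : nat) (M : lmodType R) : Prop :=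
  resolution_dim_le (@flat R) n M.

Definition superfluous (R : nzRingType) (P : lmodType R) (K : P -> Prop) : Prop :=
  forall N : submodClosed P,
    (forall x, exists y z, [/\ y \in N, K z & x = y + z]) ->
    forall x, x \in N.

Definition projective_cover (R : nzRingType) (P M : lmodType R)
    (p : {linear P -> M}) : Prop :=
  [/\ projective P, surjective p & superfluous (fun x => p x = 0)].

Definition perfect_ring (R : comNzRingType) : Prop :=
  forall M : lmodType R,
    exists (P : lmodType R) (p : {linear P -> M}), projective_cover p.

(* An idealr is proper by definition (1 \notin I). *)
Definition almost_perfect_domain (R : idomainType) : Prop :=
  forall I : idealr R,
    (exists2 a : R, a \in I & a != 0) -> perfect_ring {ideal_quot I}.

(* Main.v *)
From mathcomp Require Import all_boot all_algebra.
From mathcomp Require Import fraction generic_quotient ring_quotient.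
From mathcomp Require Import boolp classical_sets functions.
From mathcomp.multinomials Require Import freeg.
From mathcomp Require Import ring.
From HB Require Import structures.
Require Import Defs.

(** A flat module over a domain is torsion-free, and a projective module is
flat, so two implications carry the theorem: a flat M has projective dimension
at most 1, and a torsion-free M of weak dimension at most 1 is flat.

What is used of the ring is one consequence of Bass's theorem
([apd_minimum]): modulo a nonzero c, principal ideals satisfy the minimum
condition. It makes every nonzero c behave as if R / c were a finite product
of local rings with T-nilpotent maximal ideals: for a nonzero maximal ideal m
there are an idempotent modulo c that cuts out the component at m
([local_idempotent]), an element whose annihilator modulo r is m
([max_annihilator]), and every nonzero torsion element has a multiple whose
annihilator is maximal ([torsion_max_annihilator]).

Flat implies projective dimension at most 1. Write M = G / K with G free; K
has to be projective. Let A be the free module on the elements of K, with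
A -> K, embed A in a vector space W over the field of fractions and put
D = W / ker (A -> K), so that K embeds in D. If this map extends to G -> D
([divisible_extension]), then the extension lifts to G -> W because G is free,
and the lift maps K into A: a section of A -> K ([flat_kernel_projective]).
The extension property is Ext^1 (M, D) = 0 for every quotient D of a
torsion-free divisible module W. The torsion-free part of D is injective, so D
may be taken to be torsion. It then has m-primary components D_m, and, the
embedding of D in the product of the D_m having a torsion-free cokernel,
extensions into all the D_m can be corrected to an extension into D
([torsion_extension]). For one D_m ([local_extension]), Zorn's lemma gives a
maximal partial extension, defined on some H with G / H locally flat at m. If
g is not in H + m G, then the image of g in G / H is locally a free summand,
and the extension can be continued by g |-> 0. Otherwise Nakayama's lemma,
which holds for arbitrary modules by T-nilpotence, makes G / H locally
divisible, hence locally a vector space over the fractions, and the extension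
can be continued to the line of g along a sequence
g = g_0, s_n g_n = r g_(n+1) modulo H, because D_m is divisible by r.

Torsion-free and weak dimension at most 1 implies flat. Let
0 -> P1 -> P0 -> M -> 0 with P1, P0 flat. For an m maximal, choose r in m and
u whose annihilator modulo r is m. If p in P1 lies in m P0, then u p lies in
r P0, hence in r P1 since M is torsion-free, hence p is in m P1 since P1 is
flat ([maximal_pure]). From this, X (x) P1 -> X (x) P0 is injective for every
X ([tensor_mapr_inj]): after dividing X by a submodule maximal among those that
do not make the given kernel element vanish, this element is x (x) p with x
generating a copy of R or of R / m. A diagram chase concludes. *)

Set Implicit Arguments.
Unset Strict Implicit.
Unset Printing Implicit Defensive.

Import GRing.Theory.

Local Open Scope ring_scope.
Local Open Scope quotient_scope.

(** * Submodules and linear maps *)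

Section Submodules.
Variables (R : nzRingType) (V : lmodType R).

Definition submodule (H : V -> Prop) : Prop :=
  H 0 /\ forall a x y, H x -> H y -> H (a *: x + y).

Section Closure.
Variables (H : V -> Prop) (Hsub : submodule H).

Lemma submodule0 : H 0. Proof. by case: Hsub. Qed.
Lemma submoduleD x y : H x -> H y -> H (x + y).
Proof. by move=> Hx Hy; rewrite -[x]scale1r; apply: Hsub.2. Qed.
Lemma submoduleZ a x : H x -> H (a *: x).
Proof.
by move=> Hx; rewrite -[_ *: _]addr0; apply: Hsub.2 => //; apply: submodule0.
Qed.
Lemma submoduleN x : H x -> H (- x).
Proof. by rewrite -scaleN1r; apply: submoduleZ. Qed.
Lemma submoduleB x y : H x -> H y -> H (x - y).
Proof. by move=> Hx /submoduleN; apply: submoduleD. Qed.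

Definition submodule_pred : {pred V} := fun x => `[< H x >].

Fact submodule_pred_closed : submod_closed submodule_pred.
Proof.
by split=> [|a u v /asboolP ? /asboolP ?]; apply/asboolP; apply Hsub.
Qed.

Definition closed_of : submodClosed V :=
  HB.pack submodule_pred
    (GRing.isSubmodClosed.Build R V submodule_pred submodule_pred_closed).

Lemma closed_ofP x : x \in closed_of <-> H x.
Proof. by split => [/asboolP|?] //; apply/asboolP. Qed.

End Closure.
End Submodules.

Section SubmoduleType.
Variables (R : nzRingType) (V : lmodType R) (S : submodClosed V).

Definition submod := {x : V | x \in S}.
HB.instance Definition _ := Choice.on submod.
HB.instance Definition _ := SubType.on submod.
HB.instance Definition _ :=
  GRing.SubChoice_isSubLmodule.Build R V (mem S) submod (submodClosedP S).

Definition incl (x : submod) : V := val x.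
Fact incl_is_linear : linear incl. Proof. by []. Qed.
HB.instance Definition _ := GRing.isLinear.Build R submod V _ incl incl_is_linear.

Lemma incl_inj : injective incl. Proof. exact: val_inj. Qed.
Lemma inclP (x : submod) : incl x \in S. Proof. exact: valP. Qed.
Lemma incl_surj x : x \in S -> exists y : submod, incl y = x.
Proof. by move=> Sx; exists (exist _ x Sx). Qed.

End SubmoduleType.

Section LinearMaps.
Variables (R : nzRingType).

Definition linear_of (U V : lmodType R) (f : U -> V) (fP : linear f) :
  {linear U -> V} := HB.pack f (GRing.isLinear.Build R U V _ f fP).

Lemma submodule_image (U V : lmodType R) (f : {linear U -> V}) :
  submodule (fun y => exists x, f x = y).
Proof.
split=> [|a _ _ [x <-] [y <-]]; first by exists 0; rewrite linear0.
by exists (a *: x + y); rewrite linearP.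
Qed.

Lemma submodule_kernel (U V : lmodType R) (f : {linear U -> V}) :
  submodule (fun x => f x = 0).
Proof.
by split=> [|a x y fx fy]; rewrite ?linear0// linearP fx fy scaler0 addr0.
Qed.

(** The way superfluous kernels are used: a map that is onto modulo a
superfluous submodule is onto. *)
Lemma superfluous_onto (U V : lmodType R) (K : V -> Prop) (f : {linear U -> V}) :
  superfluous K -> (forall y, exists x, K (y - f x)) -> forall y, exists x, f x = y.
Proof.
move=> Ksup fK y; apply/(closed_ofP (submodule_image f))/Ksup => {}y.
have [x Kx] := fK y; exists (f x), (y - f x).
by split; [apply/closed_ofP; exists x | | rewrite addrC subrK].
Qed.

(** Most linear maps below are obtained as graphs: single-valuedness replaces
the check that a choice of values is additive. *)
Lemma linear_of_graph (U V : lmodType R) (Gr : U * V -> Prop) :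
    submodule Gr -> (forall y, Gr (0, y) -> y = 0) ->
    (forall x, exists y, Gr (x, y)) ->
  exists f : {linear U -> V}, forall x, Gr (x, f x).
Proof.
move=> Gsub Gfun Gtot; have [f Gf] := choice Gtot.
have fP : linear f.
  move=> a x y; apply/subr0_eq/Gfun.
  have /(submoduleB Gsub (Gf (a *: x + y))) := Gsub.2 a _ _ (Gf x) (Gf y).
  by rewrite -[_ - _]/(_, _) /= subrr.
by exists (linear_of fP).
Qed.

Lemma corestriction (U V : lmodType R) (S : submodClosed V)
    (f : {linear U -> V}) : (forall x, f x \in S) ->
  exists g : {linear U -> submod S}, forall x, incl (g x) = f x.
Proof.
move=> fS; have [g gP] := choice (fun x => incl_surj (fS x)).
have gl : linear g.
  by move=> a x y; apply: incl_inj; rewrite gP [f _]linearP -!gP -linearP.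
by exists (linear_of gl).
Qed.

End LinearMaps.

Section Free.
Variables (R : nzRingType) (K : choiceType).
Local Notation F := {freeg K / R}.

Lemma free_ext (V : lmodType R) (f g : {linear F -> V}) :
  (forall k, f << k >> = g << k >>) -> f =1 g.
Proof.
move=> fg; elim/freeg_ind_dom0 => [|k x D _ _ IH]; first by rewrite !linear0.
have -> : << k *g x >> = k *: << x >> :> F.
  by apply/eqP/freeg_eqP => z; rewrite coeffZ !coeffU mul1r.
by rewrite !linearD !linearZ /= fg IH.
Qed.

Lemma free_projective : projective F.
Proof.
move=> A B g f gsurj.
have [h hP] := choice (fun k => gsurj (f << k >>)).
exists (fglift h : {linear F -> A}) => x.
apply: (@free_ext _ (g \o fglift h : {linear F -> B})) => k /=.
by rewrite liftU scale1r.
Qed.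

End Free.

Lemma free_cover (R : nzRingType) (V : lmodType R) :
  exists e : {linear {freeg V / R} -> V}, surjective e.
Proof.
exists (fglift (@id V)) => v; exists << v >>.
by rewrite /= liftU scale1r.
Qed.

(** * Chains of principal ideals over a perfect ring *)

Section PerfectChain.
Variables (S : comNzRingType) (a : nat -> S).
Local Notation F := {freeg nat / S}.

(** The direct limit of S --a_0--> S --a_1--> S --a_2--> ... is the free module
on the e_i modulo the relations e_i = a_i e_(i+1). An element x supported in
i < k becomes, at stage k of the system, the scalar [bass_level k x], which is
the sum of the x_i a_i a_(i+1) ... a_(k-1). *)
Fixpoint bass_level k (x : F) : S :=
  if k is k'.+1 then (bass_level k' x + coeff k' x) * a k' else 0.

Lemma bass_level_linear k c x y :
  bass_level k (c *: x + y) = c * bass_level k x + bass_level k y.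
Proof.
elim: k => [|k IH] /=; first by rewrite mulr0 addr0.
by rewrite IH coeffD coeffZ; ring.
Qed.

Lemma bass_level_zero k : bass_level k 0 = 0.
Proof. by elim: k => //= k ->; rewrite coeff0 addr0 mul0r. Qed.

(** Truncate x below N and correct by a multiple of e_N, so that the result is
zero in the limit. This makes relations that live before stage N the fixed
points of an endomorphism with values in the relations. *)
Definition bass_trunc N (x : F) : F :=
  \sum_(i < N) << coeff (val i) x *g val i >> - << bass_level N x *g N >>.

Lemma freegUZ (T : choiceType) (R : nzRingType) c k (t : T) :
  << c * k *g t >> = c *: << k *g t >> :> {freeg T / R}.
Proof. by apply/eqP/freeg_eqP => z; rewrite coeffZ !coeffU mulrA. Qed.

Lemma bass_trunc_linear N : linear (bass_trunc N).
Proof.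
move=> c x y; rewrite /bass_trunc bass_level_linear -freegUD freegUZ.
rewrite scalerBr scaler_sumr opprD addrACA; congr (_ + _).
rewrite -big_split /=; apply: eq_bigr => i _.
by rewrite coeffD coeffZ -freegUD freegUZ.
Qed.
HB.instance Definition _ N :=
  GRing.isLinear.Build S F F _ (bass_trunc N) (bass_trunc_linear N).

(** The kernel of the map from the free module to the direct limit. *)
Definition bass_relation (x : F) : Prop :=
  exists2 k, (forall i, (k <= i)%N -> coeff i x = 0) & bass_level k x = 0.

Lemma bass_level_stable k x l : (forall i, (k <= i)%N -> coeff i x = 0) ->
  bass_level k x = 0 -> bass_level (k + l) x = 0.
Proof.
move=> x0 kx; elim: l => [|l IH]; rewrite ?addn0// addnS /= IH.
by rewrite x0 ?leq_addr// addr0 mul0r.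
Qed.

Lemma bass_relation_submodule : submodule bass_relation.
Proof.
split=> [|c x y [k xk x0] [l yl y0]].
  by exists 0%N => // i _; rewrite coeff0.
exists (k + l)%N => [i kli|].
  rewrite coeffD coeffZ xk ?(leq_trans (leq_addr _ _) kli)//.
  by rewrite yl ?(leq_trans (leq_addl _ _) kli)// mulr0 addr0.
by rewrite bass_level_linear bass_level_stable// addnC bass_level_stable// mulr0 addr0.
Qed.

Lemma coeff_bass_trunc N x i : coeff i (bass_trunc N x) =
  if (i < N)%N then coeff i x else - (bass_level N x * (i == N)%:R).
Proof.
rewrite /bass_trunc coeffB coeffU raddf_sum /= [N == i]eq_sym.
case: ltnP => iN.
  rewrite (ltn_eqF iN) mulr0 subr0 (bigD1 (Ordinal iN)) //= coeffU eqxx mulr1.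
  rewrite big1 ?addr0// => j ji; rewrite coeffU.
  by case: eqP => [ij|]; [case/eqP: ji; apply/ord_inj | rewrite mulr0].
rewrite big1 ?add0r// => j _; rewrite coeffU.
by rewrite (ltn_eqF (leq_trans (ltn_ord j) iN)) mulr0.
Qed.

Lemma bass_trunc_relation N x : bass_relation (bass_trunc N x).
Proof.
exists N.+1 => [i Ni|/=].
  by rewrite coeff_bass_trunc ltnNge ltnW//= gtn_eqF// mulr0 oppr0.
rewrite coeff_bass_trunc ltnn eqxx mulr1.
suff /(_ N (leqnn N)) -> : forall k, (k <= N)%N ->
    bass_level k (bass_trunc N x) = bass_level k x by rewrite subrr mul0r.
elim=> [//|k IH] kN /=; rewrite IH 1?ltnW// coeff_bass_trunc.
by rewrite kN.
Qed.

Lemma bass_trunc_id x : bass_relation x -> exists N, bass_trunc N x = x.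
Proof.
case=> N xN x0; exists N; apply/eqP/freeg_eqP => i.
rewrite coeff_bass_trunc x0 mul0r oppr0.
by case: ltnP => // /xN.
Qed.

Lemma bass_relation_gen n :
  bass_relation (<< n >> - a n *: << n.+1 >>).
Proof.
set x := (X in bass_relation X).
have xE i : coeff i x = (n == i)%:R - a n * (n.+1 == i)%:R.
  by rewrite coeffB coeffZ !coeffU !mul1r.
exists n.+2 => [i ni|/=].
  by rewrite xE !ltn_eqF ?mulr0 ?subr0// ltnW.
have -> : bass_level n x = 0.
  suff: forall k, (k <= n)%N -> bass_level k x = 0 by apply.
  elim=> [//|k IH] kn /=; rewrite IH 1?ltnW// xE.
  by rewrite (gtn_eqF kn) (gtn_eqF (leqW kn)) mulr0 subr0 addr0 mul0r.
rewrite !xE !eqxx gtn_eqF// ltn_eqF//.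
by rewrite mulr0 mulr1 subr0 sub0r add0r mul1r subrr mul0r.
Qed.

Lemma bass_level0 k : (0 < k)%N -> bass_level k << 0%N >> = \prod_(i < k) a i.
Proof.
case: k => // k _; elim: k => [|k IH].
  by rewrite /= big_ord1 coeffU eqxx mulr1 add0r mul1r.
rewrite big_ord_recr -IH [LHS]/=; congr (_ * _).
by rewrite (coeffU _ _ k.+1) mulr0 addr0.
Qed.

(** Bass's argument. Let P be a projective cover of the direct limit. Lifting
gives maps phi : F -> P, onto because the kernel of the cover is superfluous,
and a section sigma of phi. A kernel element y is fixed by the endomorphism
psi = phi o bass_trunc o sigma, whose values lie in the kernel; then 1 - psi
is onto and splits, and its kernel is a summand inside a superfluous submodule,
hence 0. So P is the limit itself, and sigma embeds it in F. The coordinates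
of sigma (phi (e_0)) are divisible by every product a_0 ... a_n, and one of
these products lies in the ideal that they generate. *)
Lemma perfect_chain : perfect_ring S ->
  exists n b, \prod_(i < n) a i = b * \prod_(i < n.+1) a i.
Proof.
move=> Sperf; pose N := closed_of bass_relation_submodule.
have [P [p [Pproj psurj psup]]] := Sperf (quotmod N).
pose pi : {linear F -> quotmod N} := quotmod_pi N.
have piP x : pi x = 0 <-> bass_relation x.
  by rewrite -(linear0 pi) /pi quotmod_piP subr0; apply: closed_ofP.
have [phi phiP] := free_projective pi psurj.
have phi_onto : surjective phi.
  apply: (superfluous_onto psup) => y; exists (repr (p y)).
  by rewrite linearB phiP /= quotmod_reprK subrr.
have [sigma sigmaP] := Pproj _ _ phi idfun phi_onto.
have p0 y : p y = 0 -> y = 0.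
  move=> y0; have /bass_trunc_id[n ny] : bass_relation (sigma y).
    by apply/piP; rewrite -phiP sigmaP.
  pose psi : {linear P -> P} := phi \o bass_trunc n \o sigma.
  have psiy : psi y = y by rewrite /psi/= ny sigmaP.
  have ppsi z : p (psi z) = 0.
    by rewrite /psi/= phiP; apply/piP/bass_trunc_relation.
  pose del : {linear P -> P} := idfun \- psi.
  have del_onto : surjective del.
    apply: (superfluous_onto psup) => z; exists z.
    by rewrite /= opprB addrC subrK ppsi.
  (* The image of a section h of 1 - psi is a complement to ker (1 - psi). *)
  have [h hP] := Pproj _ _ del idfun del_onto.
  have h_onto : surjective h.
    apply: (superfluous_onto psup) => z; exists (del z).
    set w := z - _; have /subr0_eq wE : del w = 0.
      by rewrite /w [del _]linearB [del (h _)]hP subrr.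
    have -> : w = psi w := wE.
    exact: ppsi.
  have [z zy] := h_onto y.
  have delE : del y = y - psi y by [].
  have z0 : z = 0 by rewrite -[z]/(idfun z) -hP zy delE psiy subrr.
  by rewrite -zy z0 linear0.
have phiR x : bass_relation x -> phi x = 0.
  by move=> /piP x0; apply: p0; rewrite phiP.
have phiS n : phi << n >> = a n *: phi << n.+1 >>.
  by apply/subr0_eq; rewrite -linearZ -linearB; apply/phiR/bass_relation_gen.
pose w n := sigma (phi << n >>).
have w0 n : w 0%N = (\prod_(i < n) a i) *: w n.
  elim: n => [|n IH]; first by rewrite big_ord0 scale1r.
  by rewrite big_ord_recr -scalerA IH /w phiS linearZ.
have : bass_relation (<< 0%N >> - w 0%N).
  by apply/piP; rewrite -phiP linearB sigmaP subrr linear0.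
case=> k bk /(bass_level_stable 1 bk); rewrite addn1 => {bk}.
rewrite addrC -scaleN1r bass_level_linear mulN1r addrC => /subr0_eq.
rewrite bass_level0// (w0 k.+2) -[_ *: _]addr0 bass_level_linear => kE.
exists k.+1, (bass_level k.+1 (w k.+2)); rewrite kE mulrC.
by rewrite bass_level_zero addr0.
Qed.

End PerfectChain.

(** * The minimum condition modulo a nonzero element *)

(** The form of the descending chain condition on principal ideals of R / c in
which it is applied: U is an arbitrary set of elements, and u is minimal among
those of its multiples that lie in U. *)
Definition minimum_condition (R : idomainType) : Prop :=
  forall (c : R) (U : R -> Prop) u0, c != 0 -> U u0 ->
  exists2 u, U u & forall v, U (u * v) -> exists b e, u = b * (u * v) + e * c.

Lemma apd_chain (R : idomainType) (R_apd : almost_perfect_domain R)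
    (c : R) (a : nat -> R) : c != 0 ->
  exists n b e, \prod_(i < n) a i = b * \prod_(i < n.+1) a i + e * c.
Proof.
(* If c is a unit, R / c is the zero ring, and the chain condition is void. *)
move=> c0; have [[e ec]|ncu] := pselect (exists e, 1 = e * c).
  by exists 0%N, 0, e; rewrite big_ord0 mul0r add0r.
pose S : {pred R} := fun x => `[< exists e, x = e * c >].
have SP : idealr_closed S.
  split=> [||x u v /asboolP[e ->] /asboolP[f ->]]; apply/asboolP => //.
    by exists 0; rewrite mul0r.
  by exists (x * e + f); ring.
pose I : idealr R := HB.pack S (isIdealr.Build R S SP).
have Iperf : perfect_ring {ideal_quot I}.
  by apply: R_apd; exists c => //; apply/asboolP; exists 1; rewrite mul1r.
have [n [b]] := perfect_chain (fun i => \pi_{ideal_quot I} (a i)) Iperf.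
rewrite -[b]reprK -!rmorph_prod -rmorphM => /eqP.
rewrite -Quotient.idealrBE => /asboolP[e eE].
by exists n, (repr b), e; rewrite -eE addrC subrK.
Qed.

Lemma apd_minimum (R : idomainType) :
  almost_perfect_domain R -> minimum_condition R.
Proof.
move=> R_apd c U u0 c0 Uu0; apply: contrapT => nomin.
have next u : exists v, U u -> U (u * v) /\ ~ exists b e, u = b * (u * v) + e * c.
  have [Uu|nUu] := pselect (U u); last by exists 0.
  apply: contrapT => nv; apply: nomin; exists u => // v Uuv.
  by apply: contrapT => nbe; apply: nv; exists v.
have [a aP] := choice next.
pose p := fix p n := if n is n'.+1 then p n' * a (p n') else u0.
have Up n : U (p n) by elim: n => //= n /aP[].
have pE n : p n = u0 * \prod_(i < n) a (p i).
  elim: n => [|n IH]; first by rewrite big_ord0 mulr1.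
  by rewrite big_ord_recr mulrA -IH.
have [n [b [e nbe]]] := apd_chain R_apd (fun i => a (p i)) c0.
have [_] := aP _ (Up n); apply; exists b, (u0 * e).
rewrite -[p n * _]/(p n.+1) pE (pE n.+1) nbe; ring.
Qed.

(** * Nonzero maximal ideals *)

(** The zero ideal is excluded because localizing at m always goes through a
nonzero element of m, modulo which the minimum condition applies; maximal
ideals that annihilate a torsion element are of this kind. *)
Record max_ideal (R : idomainType) := MaxIdeal {
  max_mem :> R -> Prop;
  max_submodule : submodule (V := R^o) max_mem;
  max_proper : ~ max_mem 1;
  max_inverse : forall a, ~ max_mem a -> exists b, max_mem (1 - a * b);
  max_nonzero : exists2 r, max_mem r & r != 0 }.

Section MaxIdeals.
Variables (R : idomainType) (m : max_ideal R).

Lemma maxMl a x : m x -> m (a * x).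
Proof. exact: (submoduleZ (max_submodule m)). Qed.
Lemma maxMr a x : m x -> m (x * a).
Proof. by rewrite mulrC; apply: maxMl. Qed.
Lemma maxD x y : m x -> m y -> m (x + y).
Proof. exact: (submoduleD (max_submodule m)). Qed.

Lemma max_prime s t : ~ m s -> ~ m t -> ~ m (s * t).
Proof.
move=> /max_inverse[b mb] /max_inverse[d md] mst; apply: (max_proper (m := m)).
rewrite (_ : 1 = (1 - s * b) + ((s * b) * (1 - t * d) + (b * d) * (s * t))).
  by apply: maxD => //; apply: maxD; apply: maxMl.
ring.
Qed.

Lemma max_primeX s k : ~ m s -> ~ m (s ^+ k).
Proof.
move=> ms; elim: k => [|k IH]; rewrite ?expr0 ?exprS.
  exact: max_proper.
exact: max_prime.
Qed.

Lemma max_unit a b : m a -> ~ m (1 - a * b).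
Proof.
move=> ma mab; apply: (max_proper (m := m)).
by rewrite -[1](subrK (a * b)); apply: maxD => //; apply: maxMr.
Qed.

End MaxIdeals.

Lemma max_separate (R : idomainType) (m n : max_ideal R) :
  m <> n -> exists2 a, m a & ~ n a.
Proof.
move=> mn; apply: contrapT => nsep.
have mn_sub a : m a -> n a.
  by move=> ma; apply: contrapT => na; apply: nsep; exists a.
have nm_sub a : n a -> m a.
  move=> na; apply: contrapT => /max_inverse[b /mn_sub nb].
  exact: max_unit na nb.
have mnE : max_mem m = max_mem n.
  by apply/funext => a; apply/propext; split=> [/mn_sub|/nm_sub].
apply: mn; case: m n mnE {nsep mn_sub nm_sub} => [p p1 p2 p3 p4] [q q1 q2 q3 q4].
move=> /= E; case: _ / E in q1 q2 q3 q4 *.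
by congr MaxIdeal; apply: Prop_irrelevance.
Qed.

Section MinimumCondition.
Variables (R : idomainType) (Rmin : minimum_condition R).

(** Modulo c, the powers of a stabilize: a is invertible on its high powers. *)
Lemma power_stable (c a : R) : c != 0 ->
  exists k b e, a ^+ k * (1 - a * b) = e * c.
Proof.
move=> c0; pose U u := exists k, u = a ^+ k.
have U1 : U 1 by exists 0%N; rewrite expr0.
have [_ [k ->] /(_ a)[]] := Rmin c0 U1; first by exists k.+1; rewrite exprSr.
by move=> b [e kE]; exists k, b, e; rewrite mulrBr mulr1 {1}kE; ring.
Qed.

Section Local.
Variable m : max_ideal R.

(** Locally at m the ideal of c contains a power of each r in m, so that
inverting r there inverts every nonzero element. *)
Lemma power_divides (c r : R) : c != 0 -> m r ->
  exists k t e, ~ m t /\ r ^+ k * t = e * c.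
Proof.
move=> c0 mr; have [k [b [e ke]]] := power_stable r c0.
by exists k, (1 - r * b), e; split=> //; apply: max_unit.
Qed.

(** A t outside m that is minimal modulo c absorbs all denominators at once:
every s outside m becomes invertible on t R / c. *)
Lemma local_stable (c : R) : c != 0 ->
  exists2 t, ~ m t & forall s, ~ m s -> exists b e, t * (1 - s * b) = e * c.
Proof.
move=> c0; have [t mt tmin] := @Rmin _ (fun u => ~ m u) _ c0 (@max_proper _ m).
 exists t => // s ms.
have [b [e tE]] := tmin s (max_prime mt ms).
by exists b, e; rewrite mulrBr mulr1 {1}tE; ring.
Qed.

(** The idempotent e of R / c that is 1 in the localization at m and 0 in the
other components: with t absorbing denominators, t = t^2 b modulo c and
e = t b. The last clause says that m acts nilpotently on the component. *)
Lemma local_idempotent (c : R) : c != 0 ->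
  exists t e, [/\ ~ m t, exists f, t * (1 - e) = f * c
    & forall a, m a -> exists k f, a ^+ k * e = f * c].
Proof.
move=> c0; have [t mt tmin] := local_stable c0.
have [b [f tf]] := tmin t mt.
exists t, (t * b); split=> //; first by exists f.
move=> a ma; have [k [d [g kg]]] := power_stable a c0.
have [d' [h th]] := tmin _ (@max_unit _ m a d ma).
exists k, (a ^+ k * b * h + d' * g * t * b).
rewrite (_ : _ * (t * b) = a ^+ k * b * (t * (1 - (1 - a * d) * d')) +
  d' * t * b * (a ^+ k * (1 - a * d))); last by ring.
by rewrite th kg; ring.
Qed.

(** R / r has a socle at m: an element u minimal among those that do not vanish
locally at m modulo r is killed, locally, by m, and multiplying it by an
element that absorbs denominators makes this hold globally. *)
Lemma max_annihilator (r : R) : r != 0 -> m r ->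
  exists u, forall a, m a <-> exists f, u * a = f * r.
Proof.
move=> r0 mr; have [t mt tmin] := local_stable r0.
pose U u := forall s f, ~ m s -> u * s <> f * r.
have U1 : U 1.
  by move=> s f ms; rewrite mul1r => sE; apply: ms; rewrite sE; apply: maxMl.
have [u Uu umin] := Rmin r0 U1.
exists (t * u) => a; split=> [ma|[f tuf]].
  have [Uua|] := pselect (U (u * a)).
    have [b [e uE]] := umin a Uua; case: (Uu (1 - a * b) e).
      exact: max_unit.
    by rewrite mulrBr mulr1 {1}uE; ring.
  move=> /existsNP[s] /existsNP[f] /not_implyP[ms] /contrapT sE.
  have [b [e tE]] := tmin s ms; exists (u * a * e + t * b * f).
  rewrite (_ : t * u * a = u * a * (t * (1 - s * b)) + t * b * (u * a * s)).
    by rewrite tE sE; ring.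
  by ring.
apply: contrapT => ma; apply: (Uu (t * a) f); first exact: max_prime.
by rewrite -tuf; ring.
Qed.

End Local.

(** Cyclic torsion modules have simple submodules: a minimal nonzero multiple
v x satisfies R a v x = R v x for each a that does not kill it. *)
Lemma torsion_max_annihilator (X : lmodType R) (x : X) (c : R) :
  c != 0 -> c *: x = 0 -> x <> 0 ->
  exists v (m : max_ideal R), forall a, m a <-> a *: (v *: x) = 0.
Proof.
move=> c0 cx x0; pose U u := u *: x <> 0.
have U1 : U 1 by rewrite /U scale1r.
have [v vx vmin] := Rmin c0 U1; pose p (a : R) := a *: (v *: x) = 0.
have psub : submodule (V := R^o) p.
  split=> [|a y z py pz]; first by rewrite /p scale0r.
  by rewrite /p scalerDl -scalerA py pz scaler0 addr0.
have p1 : ~ p 1 by rewrite /p scale1r.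
have pinv a : ~ p a -> exists b, p (1 - a * b).
  rewrite /p scalerA mulrC => /vmin[b [e vE]]; exists b.
  rewrite scalerA (_ : (1 - a * b) * v = e * c).
    by rewrite -scalerA cx scaler0.
  by rewrite mulrBl mul1r {1}vE; ring.
have pc : exists2 r, p r & r != 0.
  by exists c => //; rewrite /p scalerA mulrC -scalerA cx scaler0.
by exists v, (MaxIdeal psub p1 pinv pc).
Qed.

End MinimumCondition.

(** * Extending linear maps by Zorn's lemma *)

(** Zorn's lemma above a given set. Since only chains with a member are asked
for, P need not hold of the empty set, which is never a submodule. *)
Lemma Zorn_above (T : Type) (P : set (set T)) (A0 : set T) : P A0 ->
    (forall F : set (set T), F `<=` P -> total_on F subset ->
      (exists A, F A) -> P (\bigcup_(X in F) X))%classic ->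
  exists A, [/\ A0 `<=` A, P A & forall B, P B -> A `<=` B -> B `<=` A]%classic.
Proof.
move=> PA0 Pchain; pose Q X := P (A0 `|` X)%classic.
have [F FQ Ftot|A [QA Amax]] := @Zorn_bigcup T Q.
  have [[A FA]|F0] := pselect (exists A, F A); last first.
    rewrite /Q (_ : (_ `|` _)%classic = A0)//.
    by apply/seteqP; split=> [x [//|[X FX _]]|x]; [case: F0; exists X | left].
  rewrite /Q (_ : (_ `|` _)%classic =
      (\bigcup_(X in [set A0 `|` Y | Y in F]) X)%classic).
    apply: Pchain; last by exists (A0 `|` A)%classic; exists A.
      by move=> _ [Y FY <-]; apply: FQ.
    move=> _ _ [Y FY <-] [Z FZ <-].
    by have [YZ|ZY] := Ftot _ _ FY FZ; [left|right]; apply: setUS.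
  apply/seteqP; split=> [x [A0x|[X FX Xx]]|x [_ [Y FY <-] [A0x|Yx]]].
  - by exists (A0 `|` A)%classic; [exists A | left].
  - by exists (A0 `|` X)%classic; [exists X | right].
  - by left.
  - by right; exists Y.
exists (A0 `|` A)%classic; split=> //.
move=> B PB AB; have BE : (A0 `|` B)%classic = B.
  by apply/seteqP; split=> [x [A0x|//]|x]; [apply: AB; left | right].
move=> x Bx; apply: contrapT => nAx; have QB : Q B by rewrite /Q BE.
apply: Amax QB; split=> [y Ay|BA]; first by apply: AB; right.
by apply: nAx; right; apply: BA.
Qed.

(** When i is the inclusion of a kernel of G -> M with G projective, this is
the vanishing of Ext^1 (M, D). *)
Definition extends (R : nzRingType) (K G : lmodType R) (i : {linear K -> G})
    (D : lmodType R) : Prop :=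
  forall f : {linear K -> D}, exists F : {linear G -> D}, forall k, F (i k) = f k.

(** Partial maps from G to D are handled by their graphs. The multiplicative set
S, which acts bijectively on D, stands for the elements that are inverted:
the nonzero elements, or the complement of a maximal ideal. *)
Section PartialMaps.
Variables (R : idomainType) (G D : lmodType R) (S : R -> Prop).
Hypotheses (S1 : S 1) (SM : forall s t, S s -> S t -> S (s * t)).
Hypotheses (Sinj : forall s (d : D), S s -> s *: d = 0 -> d = 0)
  (Ssurj : forall s (d : D), S s -> exists d', s *: d' = d).
Implicit Type Gr : set (G * D).

Definition graph Gr : Prop :=
  submodule Gr /\ forall d, Gr (0, d) -> d = 0.

Definition dom_graph Gr (x : G) : Prop := exists d, Gr (x, d).

Definition saturated (H : G -> Prop) : Prop :=
  forall s x, S s -> H (s *: x) -> H x.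

Lemma graph_eq Gr x d d' : graph Gr -> Gr (x, d) -> Gr (x, d') -> d = d'.
Proof.
move=> [Gsub Gfun] xd xd'; apply/subr0_eq/Gfun.
by have := submoduleB Gsub xd xd'; rewrite -[_ - _]/(_, _)/= subrr.
Qed.

Lemma dom_graph_submodule Gr : submodule Gr -> submodule (dom_graph Gr).
Proof.
move=> Gsub; split=> [|a x y [d xd] [e ye]]; first by exists 0; apply: Gsub.1.
by exists (a *: d + e); apply: (Gsub.2 a (x, d) (y, e)).
Qed.

Definition saturation Gr : set (G * D) := fun p => exists2 s, S s & Gr (s *: p).

Lemma sub_saturation Gr : (Gr `<=` saturation Gr)%classic.
Proof. by move=> p Gp; exists 1; rewrite ?scale1r. Qed.

Lemma saturation_graph Gr : graph Gr -> graph (saturation Gr).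
Proof.
move=> [Gsub Gfun]; split.
  split=> [|a p q [s Ss Gp] [t St Gq]].
    by apply: sub_saturation; apply: Gsub.1.
  exists (s * t); first exact: SM.
  rewrite (_ : _ *: _ = (a * t) *: (s *: p) + s *: (t *: q)).
    by apply: submoduleD => //; apply: submoduleZ.
  by rewrite scalerDr !scalerA; congr (_ *: _ + _); ring.
move=> d [s Ss]; rewrite -[_ *: _]/(_, _) /= scaler0 => /Gfun.
exact: Sinj.
Qed.

Lemma saturation_dom Gr x :
  dom_graph (saturation Gr) x <-> exists2 s, S s & dom_graph Gr (s *: x).
Proof.
split=> [[d [s Ss Gx]]|[s Ss [d Gx]]]; first by exists s => //; exists (s *: d).
by have [e ed] := Ssurj d Ss; exists e, s => //; rewrite -ed in Gx.
Qed.

Section Adjoin.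
Variables (Gr : set (G * D)) (p : nat -> G * D).
Hypotheses (Ggr : graph Gr)
  (pS : forall n, exists s r, S s /\ Gr (s *: p n - r *: p n.+1))
  (pfree : forall n a, dom_graph Gr (a *: (p n).1) -> a = 0).

(** The sequence p_n = (g_n, d_n) presents a rank one module over the domain of
Gr: up to units in S, g_n is a multiple of g_(n+1) modulo that domain, and the
d_n satisfy the relations required of the images of the g_n. A constant
sequence adjoins a single free generator. *)
Definition adjoin : set (G * D) :=
  fun q => exists n s a, S s /\ Gr (s *: q - a *: p n).

Lemma adjoin_raise n k s a (q : G * D) : S s -> Gr (s *: q - a *: p n) ->
  exists t b, S t /\ Gr (t *: q - b *: p (n + k)%N).
Proof.
move=> Ss Gq; elim: k => [|k [t [b [St Gt]]]]; first by exists s, a; rewrite addn0.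
have [u [r [Su Gu]]] := pS (n + k).
exists (u * t), (b * r); split; first exact: SM.
rewrite addnS (_ : _ - _ = u *: (t *: q - b *: p (n + k)%N) +
  b *: (u *: p (n + k)%N - r *: p (n + k).+1)).
  by apply: submoduleD; try apply: submoduleZ => //; case: Ggr.
rewrite !scalerBr !scalerA [b * u]mulrC addrA subrK.
by [].
Qed.

Lemma adjoin_graph : graph adjoin.
Proof.
have [Gsub Gfun] := Ggr; split.
  split=> [|c q q' [n [s [a [Ss Gq]]]] [n' [s' [a' [Ss' Gq']]]]].
    by exists 0%N, 1, 0; split=> //; rewrite scaler0 scale0r subr0; apply: Gsub.1.
  have [t [b [St]]] := adjoin_raise n' Ss Gq.
  have [t' [b' [St']]] := adjoin_raise n Ss' Gq'.
  rewrite [(n' + n)%N]addnC; set N := p _ => Gt' Gt.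
  exists (n + n')%N, (t * t'), (c * t' * b + t * b'); split; first exact: SM.
  rewrite -/N (_ : _ - _ = (c * t') *: (t *: q - b *: N) +
      t *: (t' *: q' - b' *: N)).
    by apply: submoduleD => //; apply: submoduleZ.
  rewrite !scalerBr !scalerDr !scalerDl !scalerA opprD addrACA.
  by congr (_ *: _ - _ + _); ring.
move=> d [n [s [a [Ss]]]]; rewrite -[_ - _]/(_, _) /= scaler0 sub0r => Gd.
have a0 : a = 0.
  apply: (pfree (n := n)); exists (- (s *: d - a *: (p n).2)).
  by have := submoduleN Gsub Gd; rewrite -[- _]/(_, _) /= opprK.
by move: Gd; rewrite a0 !scale0r oppr0 subr0 => /Gfun; apply: Sinj.
Qed.

Lemma sub_adjoin : (Gr `<=` adjoin)%classic.
Proof.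
by move=> q Gq; exists 0%N, 1, 0; split=> //; rewrite scale1r scale0r subr0.
Qed.

Lemma mem_adjoin n : adjoin (p n).
Proof.
exists n, 1, 1; split=> //; rewrite !scale1r subrr.
by have [[]] := Ggr.
Qed.

Lemma adjoin_dom x : dom_graph adjoin x <->
  exists n s a, S s /\ dom_graph Gr (s *: x - a *: (p n).1).
Proof.
split=> [[d [n [s [a [Ss Gx]]]]]|[n [s [a [Ss [d Gx]]]]]].
  by exists n, s, a; split=> //; exists (s *: d - a *: (p n).2).
have [e ed] := Ssurj (d + a *: (p n).2) Ss.
exists e, n, s, a; split=> //; rewrite -[_ - _]/(_, _) /= ed addrK.
by [].
Qed.

Lemma adjoin_saturated : saturated (dom_graph adjoin).
Proof.
move=> s x Ss /adjoin_dom[n [t [a [St Gx]]]]; apply/adjoin_dom.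
exists n, (t * s), a; split; first exact: SM.
by rewrite -scalerA.
Qed.

End Adjoin.

(** The Zorn argument common to the injectivity of vector spaces and to the
local case: Q is the property of the domains that makes a further step
possible, and Qstep is this step. *)
Lemma graph_extension (K : lmodType R) (i : {linear K -> G}) (Q : set (set G)) :
    injective i ->
    Q (fun x => exists2 s, S s & exists k, s *: x = i k) ->
    (forall F : set (set G), F `<=` Q -> total_on F subset ->
      (exists H, F H) -> Q (\bigcup_(H in F) H))%classic ->
    (forall Gr, graph Gr -> Q (dom_graph Gr) -> (exists x, ~ dom_graph Gr x) ->
      exists Gr', [/\ graph Gr', Q (dom_graph Gr'), Gr `<=` Gr'
        & exists2 p, Gr' p & ~ Gr p]%classic) ->
  extends i D.
Proof.
move=> i_inj Q0 Qchain Qstep f.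
pose Gr0 : set (G * D) := fun p => exists k, p = (i k, f k).
have Gr0P : graph Gr0.
  split; last first.
    by move=> d [k [/esym]]; rewrite -(linear0 i) => /i_inj -> ->; rewrite linear0.
  split=> [|a _ _ [k ->] [l ->]]; first by exists 0; rewrite !linear0.
  by exists (a *: k + l); rewrite !linearP.
pose P Gr := graph Gr /\ Q (dom_graph Gr).
have P0 : P (saturation Gr0).
  split; first exact: saturation_graph.
  suff <- : (fun x => exists2 s, S s & exists k, s *: x = i k) =
    dom_graph (saturation Gr0) by [].
  apply/funext => x; apply/propext; split.
    move=> [s Ss [k xk]]; apply/saturation_dom; exists s => //.
    by exists (f k), k; rewrite xk.
  by move/saturation_dom => [s Ss [d [k [xk _]]]]; exists s => //; exists k.
have [F FP Ftot Fne|Gr [Gr0sub [Ggr GQ] Gmax]] := Zorn_above P0.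
  split.
    split.
      have [X FX] := Fne.
      split=> [|a p q [Y FY Yp] [Z FZ Zq]].
        by exists X => //; have [[[]]] := FP _ FX.
      have [W [FW Wp Wq]] : exists W, [/\ F W, W p & W q].
        have [YZ|ZY] := Ftot _ _ FY FZ; first by exists Z; split=> //; apply: YZ.
        by exists Y; split=> //; apply: ZY.
      by exists W => //; have [[[_ WP] _] _] := FP _ FW; apply: WP.
    by move=> d [X FX]; have [[_ Xfun] _] := FP _ FX; apply: Xfun.
  rewrite (_ : dom_graph _ = (\bigcup_(H in [set dom_graph X | X in F]) H)%classic).
    apply: Qchain.
    - by move=> _ [X FX <-]; case: (FP _ FX).
    - move=> _ _ [X FX <-] [Y FY <-].
      by have [XY|YX] := Ftot _ _ FX FY; [left|right] => x [d ?]; exists d; auto.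
    - by have [X FX] := Fne; exists (dom_graph X), X.
  apply/seteqP; split=> [x [d [X FX Xx]]|x [_ [X FX <-] [d Xx]]].
    by exists (dom_graph X); [exists X | exists d].
  by exists d, X.
have Gtot x : dom_graph Gr x.
  apply: contrapT => nx; have [|Gr' [Ggr' GQ' GG' [p G'p nGp]]] := Qstep _ Ggr GQ.
    by exists x.
  by apply: nGp; apply: (Gmax Gr').
have [F FP] := linear_of_graph Ggr.1 Ggr.2 Gtot.
exists F => k; apply: graph_eq Ggr (FP _) _.
by apply/Gr0sub/sub_saturation; exists k.
Qed.

End PartialMaps.

Definition divisible (R : idomainType) (D : lmodType R) : Prop :=
  forall c (d : D), c != 0 -> exists d', c *: d' = d.

(** Torsion-free divisible modules are the vector spaces over the fractions.
With S the nonzero elements, a saturated domain H has a torsion-free quotient,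
so that any g outside H is free over H and may be sent to 0. *)
Lemma torsion_free_divisible_injective (R : idomainType) (K G D : lmodType R)
    (i : {linear K -> G}) :
  injective i -> torsion_free D -> divisible D -> extends i D.
Proof.
move=> i_inj Dtf Ddiv; pose S (s : R) : Prop := s != 0.
have S1 : S 1 by apply: oner_neq0.
have SM s t : S s -> S t -> S (s * t) by rewrite /S => ? ?; rewrite mulf_neq0.
have Sinj s (d : D) : S s -> s *: d = 0 -> d = 0.
  by move=> /eqP s0 /Dtf[].
have Ssurj s (d : D) : S s -> exists d', s *: d' = d by apply: Ddiv.
apply: (graph_extension S1 SM Sinj Ssurj (Q := saturated S)) => //.
- move=> s x Ss [t St [k xk]]; exists (t * s); first exact: SM.
  by exists k; rewrite -scalerA.
- by move=> F FQ _ _ s x Ss [H FH Hx]; exists H => //; apply: FQ Hx.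
move=> Gr Ggr Gsat [x nx]; pose p (n : nat) : G * D := (x, 0).
have pS n : exists s r, S s /\ Gr (s *: p n - r *: p n.+1).
  by exists 1, 1; split=> //; rewrite subrr; case: Ggr => [[]].
have pfree n a : dom_graph Gr (a *: (p n).1) -> a = 0.
  by move=> ax; apply/eqP; apply: contrapT => /negP a0; apply: nx; apply: Gsat ax.
exists (adjoin S Gr p); split.
- exact: adjoin_graph.
- exact: adjoin_saturated.
- exact: sub_adjoin.
- exists (x, 0); first exact: (mem_adjoin S1 p Ggr 0).
  by move=> xG; apply: nx; exists 0.
Qed.

(** * Flat modules *)

Section IdealProduct.
Variables (R : nzRingType) (V : lmodType R).

Definition ideal_mul (J : R -> Prop) (y : V) : Prop :=
  y \in span (fun y => exists j x, J j /\ y = j *: x).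

Lemma ideal_mul_submodule J : submodule (ideal_mul J).
Proof.
have [s0 sP] := span_submod_closed (fun y : V => exists j x, J j /\ y = j *: x).
by split=> [//|a x y Jx Jy]; apply: sP.
Qed.

Lemma mem_ideal_mul (J : R -> Prop) j x : J j -> ideal_mul J (j *: x).
Proof. by move=> Jj; apply: mem_span; exists j, x. Qed.

Lemma ideal_mul_ind (J : R -> Prop) (N : V -> Prop) : submodule N ->
  (forall j x, J j -> N (j *: x)) -> forall y, ideal_mul J y -> N y.
Proof.
move=> Nsub JN y /asboolP/(_ (closed_of Nsub)) yN; apply/closed_ofP/yN.
by move=> _ [j [x [Jj ->]]]; apply/closed_ofP/JN.
Qed.

Lemma ideal_mul_sub (I J : R -> Prop) y :
  (forall a, I a -> J a) -> ideal_mul I y -> ideal_mul J y.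
Proof.
by move=> IJ; apply: ideal_mul_ind (ideal_mul_submodule J) _ _ => j x /IJ;
   apply: mem_ideal_mul.
Qed.

End IdealProduct.
Arguments ideal_mul_submodule {R V J}.

Section TensorFacts.
Variables (R : comNzRingType).

Lemma pure0l (A B : lmodType R) (b : B) : pure (0 : A) b = 0.
Proof. by rewrite -(scale0r (0 : A)) pureZl scale0r. Qed.

Lemma pure0r (A B : lmodType R) (a : A) : pure a (0 : B) = 0.
Proof. by rewrite -(scale0r (0 : B)) pureZr scale0r. Qed.

Lemma tensor_ext (A B C : lmodType R) (f g : {linear tensor A B -> C}) :
  (forall a b, f (pure a b) = g (pure a b)) -> f =1 g.
Proof.
move=> fg; apply: tensor_ind => // [x y fx fy|r x fx].
  by rewrite !linearD fx fy.
by rewrite !linearZ /= fx.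
Qed.

Definition lift_linear (A B C : lmodType R) (h : A -> B -> C)
    (hP : bilinear_map h) : {linear tensor A B -> C} :=
  linear_of (tensor_lift_is_linear hP).

Lemma lift_linearE (A B C : lmodType R) (h : A -> B -> C)
    (hP : bilinear_map h) a b : lift_linear hP (pure a b) = h a b.
Proof. exact: tensor_lift_pure. Qed.

End TensorFacts.

Section FlatAnnihilator.
Variables (R : comNzRingType) (P : lmodType R).
Hypothesis Pflat : flat P.

(** Flatness applied to the inclusion of R x in X: since R x is R modulo the
annihilator I of x, the product of R x with P is P / I P. *)
Lemma flat_pure_eq0 (X : lmodType R) (x : X) (q : P) :
  pure x q = 0 -> ideal_mul (fun a => a *: x = 0) q.
Proof.
move=> xq; pose N := ideal_mul (V := P) (fun a => a *: x = 0).
have Nsub : submodule N := ideal_mul_submodule.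
have Ysub : submodule (fun y => exists r : R, r *: x = y).
  split=> [|a _ _ [r <-] [s <-]]; first by exists 0; rewrite scale0r.
  by exists (a * r + s); rewrite scalerDl scalerA.
pose Y := submod (closed_of Ysub).
have [r rP] : {r : Y -> R & forall y, r y *: x = incl y}.
  apply: (@choice _ _ (fun (y : Y) s => s *: x = incl y)) => y.
  by have /closed_ofP := inclP y.
have ann_N a (v : P) : a *: x = 0 -> N (a *: v) by apply: mem_ideal_mul.
pose h (y : Y) (v : P) := quotmod_pi (closed_of Nsub) (r y *: v).
have hP : bilinear_map h.
  split=> [v a y z|y a v w] /=; last by rewrite /h -linearP scalerDr !scalerA mulrC.
  rewrite /h -linearP; apply/quotmod_piP/closed_ofP.
  rewrite scalerA -scalerDl -scalerBl; apply: ann_N.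
  by rewrite scalerBl scalerDl -scalerA !rP linearP subrr.
have [y yx] : exists y : Y, incl y = x.
  by apply/incl_surj/closed_ofP; exists 1; rewrite scale1r.
have y0 : pure y q = 0.
  have := Pflat (f := @incl _ _ (closed_of Ysub)) (@incl_inj _ _ _).
  by apply; rewrite tensor_map_pure /= yx xq linear0.
have /eqP : lift_linear hP (pure y q) = 0 by rewrite y0 linear0.
rewrite lift_linearE /h -(linear0 (quotmod_pi (closed_of Nsub))) => /eqP.
move=> /quotmod_piP; rewrite subr0 => /closed_ofP yq.
rewrite -[q](subrK (r y *: q)); apply: submoduleD => //.
rewrite -[X in X - _]scale1r -scalerBl; apply: ann_N.
by rewrite scalerBl rP yx scale1r subrr.
Qed.

(** The case of the class of a in R / J, whose annihilator is the colon ideal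
J : a. *)
Lemma flat_colon (J : R -> Prop) (a : R) (x : P) : submodule (V := R^o) J ->
  ideal_mul J (a *: x) -> ideal_mul (fun b => J (b * a)) x.
Proof.
move=> Jsub ax; pose pi : {linear R^o -> _} := quotmod_pi (closed_of Jsub).
have pi0 b : pi b = 0 <-> J b.
  by rewrite -(linear0 pi) /pi quotmod_piP subr0; apply: closed_ofP.
have pi1 y : ideal_mul J y -> pure (pi 1) y = 0.
  apply: (@ideal_mul_ind _ _ _ (fun y => pure (pi 1) y = 0)); last first.
    move=> j v /pi0 j0; rewrite pureZr -pureZl -linearZ /=.
    by rewrite -[_ *: _]/(j * 1) mulr1 j0 pure0l.
  split=> [|b u v u0 v0]; first exact: pure0r.
  by rewrite pureDr pureZr u0 v0 scaler0 addr0.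
have : pure (pi a) x = 0.
  by rewrite -[a]mulr1 -[a * 1]/(a *: (1 : R^o)) linearZ pureZl -pureZr pi1.
move=> /flat_pure_eq0; apply: ideal_mul_sub => b.
by rewrite -linearZ => /pi0.
Qed.

End FlatAnnihilator.

Lemma flat_torsion_free (R : idomainType) (M : lmodType R) :
  flat M -> torsion_free M.
Proof.
move=> Mflat a x ax; have [->|a0] := eqVneq a 0; first by left.
right; have z_sub : submodule (V := R^o) (fun b : R => b = 0).
  by split=> // c u v -> ->; rewrite scaler0 addr0.
have /(flat_colon Mflat z_sub) : ideal_mul (fun b : R => b = 0) (a *: x).
  by rewrite ax; apply: submodule0 ideal_mul_submodule.
apply: (@ideal_mul_ind _ _ _ (fun y => y = 0)) => [|b y /eqP].
  by split=> // c u v -> ->; rewrite scaler0 addr0.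
by rewrite mulf_eq0 (negbTE a0) orbF => /eqP ->; rewrite scale0r.
Qed.

Section ProjectiveFlat.
Variables (R : comNzRingType) (P : lmodType R).

Lemma freeg_sum_on (K : choiceType) (D : {freeg K / R}) (L : seq K) :
  uniq L -> {subset dom D <= L} -> D = \sum_(k <- L) << coeff k D *g k >>.
Proof.
move=> Lu DL; apply/eqP/freeg_eqP => x; rewrite raddf_sum /=.
have [xL|xL] := boolP (x \in L).
  rewrite (bigD1_seq x) //= coeffU eqxx mulr1 big1 ?addr0// => k kx.
  by rewrite coeffU (negbTE kx) mulr0.
rewrite coeff_outdom; last by apply: contra xL => /DL.
rewrite big_seq big1// => k kL; rewrite coeffU.
by case: eqP kL => [->|_ _]; rewrite ?(negbTE xL)// mulr0.
Qed.

(** Dual basis argument: a section s of the free cover of P gives coordinates,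
hence maps A (x) P -> A natural in A, and these determine an element of
A (x) P. *)
Lemma projective_flat : projective P -> flat P.
Proof.
move=> Pproj A B f f_inj.
pose e : {linear {freeg P / R} -> P} := fglift (@id P).
have e_surj : surjective e by move=> p; exists << p >>; rewrite /e/= liftU scale1r.
have [s sP] := Pproj _ _ e idfun e_surj.
have cP (C : lmodType R) p :
    bilinear_map (fun (c : C) (v : P) => coeff p (s v) *: c).
  split=> [v a c d|c a v w] /=; first by rewrite scalerDr !scalerA mulrC.
  by rewrite linearP coeffD coeffZ scalerDl scalerA.
have [co coE] : exists co : forall C : lmodType R, P -> {linear tensor C P -> C},
    forall C p c v, co C p (pure c v) = coeff p (s v) *: c.
  by exists (fun C p => lift_linear (cP C p)) => C p c v; apply: lift_linearE.
have expand (x : tensor A P) : exists L : seq P, forall L', uniq L' ->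
    {subset L <= L'} -> x = \sum_(p <- L') pure (co A p x) p.
  elim/tensor_ind: x => [a b|x y [L xL] [L' yL]|r x [L xL]].
  - exists (dom (s b)) => L Lu bL.
    have bE : b = \sum_(p <- L) coeff p (s b) *: p.
      rewrite -{1}[b]/(idfun b) -sP {1}(freeg_sum_on Lu bL) linear_sum /=.
      by apply: eq_bigr => p _; rewrite liftU.
    rewrite [RHS](eq_bigr (fun p => pure a (coeff p (s b) *: p))) => [|p _].
      2: by rewrite coE pureZl -pureZr.
    rewrite {1}bE.
    elim: (L) => [|p l IH]; rewrite ?big_nil ?big_cons.
      exact: pure0r.
    by rewrite pureDr IH.
  - exists (L ++ L') => l lu ll.
    transitivity (\sum_(p <- l) pure (co A p x) p + \sum_(p <- l) pure (co A p y) p).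
      by congr (_ + _); [apply: xL | apply: yL] => // p pl; apply: ll;
        rewrite mem_cat pl ?orbT.
    by rewrite -big_split; apply: eq_bigr => p _; rewrite linearD pureDl.
  - exists L => l lu ll.
    transitivity (r *: \sum_(p <- l) pure (co A p x) p).
      by congr (_ *: _); apply: xL.
    by rewrite scaler_sumr; apply: eq_bigr => p _; rewrite linearZ pureZl.
have coN p x : co B p (tensor_map f x) = f (co A p x).
  pose l : {linear tensor A P -> B} := co B p \o tensor_map f (M := P).
  pose l' : {linear tensor A P -> B} := f \o co A p.
  suff : l =1 l' by apply.
  apply: tensor_ext => a b; rewrite /l /l' /=.
  by rewrite tensor_map_pure !coE linearZ.
apply: raddf_inj => x fx; have [L xL] := expand x.
rewrite (xL (undup L) (undup_uniq L)); last by move=> p; rewrite mem_undup.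
rewrite big1// => p _; rewrite (_ : co A p x = 0) ?pure0l//.
by apply: f_inj; rewrite -coN fx !linear0.
Qed.

End ProjectiveFlat.

Lemma ideal_mul_map (R : nzRingType) (V W : lmodType R) (f : {linear V -> W}) J y :
  ideal_mul J y -> ideal_mul J (f y).
Proof.
apply: (@ideal_mul_ind _ _ _ (fun y => ideal_mul J (f y))) => [|j x Jj].
  have Jsub : submodule (ideal_mul (V := W) J) := ideal_mul_submodule.
  split=> [|a x y' Jx Jy]; first by rewrite linear0; apply: submodule0.
  by rewrite linearP; apply: Jsub.2.
by rewrite linearZ; apply: mem_ideal_mul.
Qed.

Lemma ideal_mul_lift (R : nzRingType) (V W : lmodType R) (f : {linear V -> W}) J w :
  surjective f -> ideal_mul J w -> exists2 v, ideal_mul J v & f v = w.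
Proof.
move=> f_surj.
apply: (@ideal_mul_ind _ _ _ (fun w => exists2 v, ideal_mul J v & f v = w))
  => [|j x Jj].
  have Jsub : submodule (ideal_mul (V := V) J) := ideal_mul_submodule.
  split=> [|a _ _ [x Jx <-] [y Jy <-]].
    by exists 0; rewrite ?linear0//; apply: submodule0.
  by exists (a *: x + y); rewrite ?linearP//; apply: Jsub.2.
have [v <-] := f_surj x; exists (j *: v); rewrite ?linearZ//.
exact: mem_ideal_mul.
Qed.

(** * Extension into a divisible module that is primary for a maximal ideal *)

Section LocalExtension.
Variables (R : idomainType) (Rmin : minimum_condition R) (m : max_ideal R).

Definition primary (D : lmodType R) : Prop :=
  forall (x : D) a, m a -> exists k, a ^+ k *: x = 0.

Lemma power_comaximal (s b : R) k : exists d, 1 - (1 - s * b) ^+ k = s * d.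
Proof.
elim: k => [|k [d kd]]; first by exists 0; rewrite expr0 subrr mulr0.
exists (b + (1 - s * b) * d); rewrite exprS.
rewrite (_ : 1 - _ = s * b + (1 - s * b) * (1 - (1 - s * b) ^+ k)); last by ring.
by rewrite kd; ring.
Qed.

Section Primary.
Variables (D : lmodType R) (Dprim : primary D).

(** Elements outside m act bijectively on D, since s is invertible modulo m and
m acts nilpotently on each element. *)
Lemma primary_unit s x : ~ m s -> exists d, (s * d) *: (x : D) = x.
Proof.
move=> /max_inverse[b mb]; have [k kx] := Dprim x mb.
have [d kd] := power_comaximal s b k.
by exists d; rewrite -kd scalerBl scale1r kx subr0.
Qed.

Lemma primary_inj s (x : D) : ~ m s -> s *: x = 0 -> x = 0.
Proof.
move=> ms sx; have [d <-] := primary_unit x ms.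
by rewrite mulrC -scalerA sx scaler0.
Qed.

Lemma primary_surj s (x : D) : ~ m s -> exists y, s *: y = x.
Proof.
move=> ms; have [d dx] := primary_unit x ms.
by exists (d *: x); rewrite scalerA.
Qed.

End Primary.

Local Notation S := (fun s => ~ m s).

Section LocallyFlatQuotient.
Variables (G : lmodType R).
Implicit Types (H : G -> Prop) (J : R -> Prop).

Definition ideal_mul_add J H (y : G) : Prop :=
  exists h z, [/\ H h, ideal_mul J z & y = h + z].

Lemma ideal_mul_add_sub (I J : R -> Prop) H H' y :
  (forall a, I a -> J a) -> (forall h, H h -> H' h) ->
  ideal_mul_add I H y -> ideal_mul_add J H' y.
Proof.
move=> IJ HH' [h [z [Hh Iz ->]]]; exists h, z; split=> //; first exact: HH'.
exact: ideal_mul_sub Iz.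
Qed.

Lemma ideal_mul_add_submodule J H : submodule H -> submodule (ideal_mul_add J H).
Proof.
move=> Hsub; have Jsub : submodule (ideal_mul (V := G) J) := ideal_mul_submodule.
split=> [|a _ _ [h [z [Hh Jz ->]]] [h' [z' [Hh' Jz' ->]]]].
  by exists 0, 0; split; [apply: Hsub.1 | apply: Jsub.1 | rewrite addr0].
exists (a *: h + h'), (a *: z + z'); split; [exact: Hsub.2 | exact: Jsub.2 |].
by rewrite scalerDr addrACA.
Qed.

Lemma mem_ideal_mul_addl J H h : H h -> ideal_mul_add J H h.
Proof.
move=> Hh; exists h, 0; split; rewrite ?addr0//.
exact: submodule0 ideal_mul_submodule.
Qed.

Lemma mem_ideal_mul_addr J H z : submodule H -> ideal_mul J z -> ideal_mul_add J H z.
Proof.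
by move=> Hsub Jz; exists 0, z; split; rewrite ?add0r//; apply: submodule0.
Qed.

(** The localization of G / H at m is flat, in the form given by [flat_colon]:
a x in J M forces x in (J : a) M. Unlike flatness of the quotient, this visibly
passes to unions of chains. *)
Definition locally_flat H : Prop :=
  saturated S H /\
  forall J a x, submodule (V := R^o) J -> ideal_mul_add J H (a *: x) ->
    exists2 s, ~ m s & ideal_mul_add (fun b => J (b * a)) H (s *: x).

Lemma zero_ideal_mul (z : G) : ideal_mul (fun a : R => a = 0) z -> z = 0.
Proof.
apply: (@ideal_mul_ind _ _ _ (fun z => z = 0)) => [|j x ->]; last by rewrite scale0r.
by split=> // a x y -> ->; rewrite scaler0 addr0.
Qed.

Lemma locally_flat_torsion_free H a x :
  locally_flat H -> a != 0 -> H (a *: x) -> H x.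
Proof.
move=> [Hsat Hflat] a0 Hax.
have [|s ms [h [z [Hh Jz sx]]]] :=
    Hflat (fun b => b = 0) a x _ (mem_ideal_mul_addl _ Hax).
  by split=> // c u v -> ->; rewrite scaler0 addr0.
apply: Hsat (ms) _; rewrite sx (@zero_ideal_mul z) ?addr0//.
apply: ideal_mul_sub Jz => b /eqP.
by rewrite mulf_eq0 (negbTE a0) orbF => /eqP.
Qed.

Section Step.
Variables (D : lmodType R) (Dprim : primary D) (Ddiv : divisible D).
Variables (Gr : set (G * D)) (Ggr : graph Gr).
Local Notation H := (dom_graph Gr).
Hypothesis (Hflat : locally_flat H).

Let S1 : S 1. Proof. exact: max_proper. Qed.
Let SM s t : S s -> S t -> S (s * t). Proof. exact: max_prime. Qed.
Let Sinj s (d : D) : S s -> s *: d = 0 -> d = 0. Proof. exact: primary_inj. Qed.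
Let Ssurj s (d : D) : S s -> exists d', s *: d' = d. Proof. exact: primary_surj. Qed.
Let Hsub : submodule H. Proof. exact: dom_graph_submodule Ggr.1. Qed.

Section Generator.
Variable g : G.
Hypothesis gH : ~ ideal_mul_add m H g.

(** Modulo H, g is locally part of a basis: if b g vanishes modulo J, flatness
puts g in (J : b) G, which would be inside m G if J : b were inside m. *)
Lemma generator_coef J b : submodule (V := R^o) J ->
  ideal_mul_add J H (b *: g) -> exists2 t, ~ m t & J (t * b).
Proof.
move=> Jsub /(Hflat.2 _ _ _ Jsub)[s ms sg]; apply: contrapT => nt.
have msub := ideal_mul_add_submodule m Hsub.
apply: gH; have {}sg : ideal_mul_add m H (s *: g).
  apply: ideal_mul_add_sub sg => // t Jt; apply: contrapT => mt.
  by apply: nt; exists t.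
have [d md] := max_inverse ms.
rewrite -[g]scale1r -(subrK (s * d) 1) scalerDl [s * d]mulrC -scalerA.
apply: submoduleD => //; last exact: submoduleZ.
by apply: mem_ideal_mul_addr => //; apply: mem_ideal_mul; rewrite mulrC.
Qed.

Let p (n : nat) : G * D := (g, 0).

Let pS n : exists s r, S s /\ Gr (s *: p n - r *: p n.+1).
Proof. by exists 1, 1; split=> //; rewrite subrr; apply: submodule0 Ggr.1. Qed.

Let pfree n a : dom_graph Gr (a *: (p n).1) -> a = 0.
Proof.
move=> /mem_ideal_mul_addl ag.
have [|t mt /eqP] := @generator_coef (fun b => b = 0) a _ (ag _).
  by split=> // c u v -> ->; rewrite scaler0 addr0.
rewrite mulf_eq0 => /orP[/eqP t0|/eqP//]; case: mt; rewrite t0.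
exact: submodule0 (max_submodule m).
Qed.

(** Flatness survives: if a x = b g modulo J and H, then [generator_coef] for
the ideal J + a R gives b = c a modulo J, locally, and flatness of G / H applies
to a (x - c g). *)
Lemma adjoin_generator : exists Gr', [/\ graph Gr', locally_flat (dom_graph Gr'),
  Gr `<=` Gr' & exists2 q, Gr' q & ~ Gr q]%classic.
Proof.
exists (adjoin S Gr p); split; last first.
- exists (g, 0); first exact: (mem_adjoin S1 p Ggr 0).
  by move=> gG; apply: gH; apply: mem_ideal_mul_addl; exists 0.
- exact: sub_adjoin.
- split; first exact: adjoin_saturated.
  move=> J a x Jsub [h' [z [/(adjoin_dom Ssurj)[n [s [b [ms]]]] /= Hh Jz ax]]].
  set h := s *: h' - _ in Hh.
  have zsub : submodule (ideal_mul (V := G) J) := ideal_mul_submodule.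
  have hE : s *: (a *: x) = h + s *: z + b *: g.
    by rewrite ax scalerDr /h addrAC subrK.
  have Jasub : submodule (V := R^o) (fun y : R => exists j c, J j /\ y = j + c * a).
    split=> [|c _ _ [j [d [Jj ->]]] [j' [d' [Jj' ->]]]].
      by exists 0, 0; rewrite mul0r addr0; split=> //; apply: Jsub.1.
    exists (c * j + j'), (c * d + d'); split; first exact: Jsub.2.
    by rewrite -[c *: _]/(c * _); ring.
  have [t mt [j [c [Jj tb]]]] :
      exists2 t, ~ m t & exists j c, J j /\ t * b = j + c * a.
    apply: (generator_coef Jasub).
    have -> : b *: g = - h + (a *: (s *: x) + (- s) *: z).
      by rewrite scalerA mulrC -scalerA hE scaleNr addrAC addrK addKr.
    exists (- h), (a *: (s *: x) + (- s) *: z); split=> //; first exact: submoduleN.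
    apply: (submoduleD ideal_mul_submodule).
      apply: mem_ideal_mul; exists 0, 1; rewrite add0r mul1r; split=> //.
      exact: Jsub.1.
    apply: (submoduleZ ideal_mul_submodule); apply: ideal_mul_sub Jz => y Jy.
    by exists y, 0; rewrite mul0r addr0.
  have [|u mu [h2 [z2 [Hh2 Jz2 uE]]]] :=
      Hflat.2 J a (t *: (s *: x) - c *: g) Jsub.
    exists (t *: h), (t *: (s *: z) + j *: g); split.
    - exact: submoduleZ.
    - apply: (submoduleD zsub); last exact: mem_ideal_mul.
      by do 2![apply: (submoduleZ zsub)].
    rewrite scalerBr (_ : a *: (t *: (s *: x)) = t *: (s *: (a *: x))); last first.
      by rewrite !scalerA; congr (_ *: _); ring.
    rewrite hE !scalerDr [t *: (b *: g)]scalerA tb scalerDl [a *: (c *: g)]scalerA.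
    by rewrite [a * c]mulrC -!addrA subrr addr0.
  exists (u * (t * s)); first by do ![apply: SM => //].
  exists (h2 + (u * c) *: g), z2; split=> //.
    apply/(adjoin_dom Ssurj); exists 0%N, 1, (u * c); split=> //.
    by rewrite scale1r addrK.
  by rewrite addrAC -uE scalerBr !scalerA subrK.
- exact: adjoin_graph.
Qed.

End Generator.

Section Division.
Hypothesis mH : forall g, ideal_mul_add m H g.
Variable r : R.
Hypotheses (mr : m r) (r0 : r != 0).

(** Nakayama's lemma by T-nilpotence, for the quotient C of G / H by r, locally
at m: if C is not 0, take u minimal with u C nonzero; as C = m C there is an a
in m with u a C nonzero, and u is a multiple of u a modulo r, which kills u C
because 1 - a b is outside m. *)
Lemma nakayama y : exists s h y', [/\ ~ m s, H h & s *: y = h + r *: y'].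
Proof.
pose L y := exists s h y', [/\ ~ m s, H h & s *: y = h + r *: y'].
have Lsat s x : ~ m s -> L (s *: x) -> L x.
  move=> ms [t [h [x' [mt Hh tx]]]]; exists (t * s), h, x'; split=> //.
    exact: SM.
  by rewrite -scalerA.
have Lsub : submodule L.
  split=> [|a x x' [s [h [w [ms Hh sx]]]] [s' [h' [w' [ms' Hh' sx']]]]].
    by exists 1, 0, 0; rewrite !scaler0 addr0; split=> //; apply: Hsub.1.
  exists (s * s'), ((a * s') *: h + s *: h'), ((a * s') *: w + s *: w').
  split; [exact: SM | by apply: submoduleD => //; apply: submoduleZ |].
  transitivity ((a * s') *: (s *: x) + s *: (s' *: x')).
    by rewrite scalerDr !scalerA; congr (_ *: _ + _); ring.
  rewrite sx sx' !scalerDr addrACA !scalerA.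
  by congr (_ + (_ *: _ + _ *: _)); ring.
have LH h : H h -> L h.
  by move=> Hh; exists 1, h, 0; rewrite scale1r scaler0 addr0.
have Lr x : L (r *: x).
  by exists 1, 0, x; rewrite scale1r add0r; split=> //; apply: Hsub.1.
apply: contrapT => ny; pose U (u : R) := exists y, ~ L (u *: y).
have U1 : U 1 by exists y; rewrite scale1r.
have [u [x nux] umin] := Rmin r0 U1.
have [h [z [Hh mz xE]]] := mH x.
apply: nux; rewrite xE scalerDr; apply: submoduleD => //.
  exact/LH/(submoduleZ Hsub).
move: z mz {xE}; apply: (@ideal_mul_ind _ _ _ (fun z => L (u *: z))).
  split=> [|a v w Lv Lw]; first by rewrite scaler0; apply: Lsub.1.
  by rewrite scalerDr scalerA mulrC -scalerA; apply: Lsub.2.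
move=> a v ma; apply: contrapT => nav.
have [|b [f uE]] := umin a; first by exists v; rewrite -scalerA.
apply: nav; rewrite scalerA mulrC -scalerA; apply: submoduleZ => //.
apply: (Lsat (1 - a * b)); first exact: max_unit.
rewrite scalerA (_ : _ * u = r * f); first by rewrite -scalerA; apply: Lr.
by rewrite mulrBl mul1r {1}uE; ring.
Qed.

Lemma division c y : c != 0 -> exists s h y', [/\ ~ m s, H h & s *: y = h + c *: y'].
Proof.
move=> c0; have [k [t [f [mt rt]]]] := power_divides Rmin c0 mr.
have [s [h [y' [ms Hh sy]]]] :
    exists s h y', [/\ ~ m s, H h & s *: y = h + r ^+ k *: y'].
  elim: (k) => [|l [s [h [y' [ms Hh sy]]]]].
    by exists 1, 0, y; rewrite expr0 !scale1r add0r; split=> //; apply: Hsub.1.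
  have [s' [h' [y'' [ms' Hh' sy']]]] := nakayama y'.
  exists (s' * s), (s' *: h + r ^+ l *: h'), y''; split; first exact: SM.
    by apply: submoduleD => //; apply: submoduleZ.
  rewrite -scalerA sy scalerDr scalerA mulrC -scalerA sy' scalerDr addrA.
  by rewrite scalerA exprSr.
exists (t * s), (t *: h), (f *: y'); split; [exact: SM | exact: submoduleZ |].
by rewrite -scalerA sy scalerDr !scalerA [t * _]mulrC rt [f * c]mulrC.
Qed.

Variable g : G.
Hypothesis ng : ~ H g.

(** The localization of G / H at m is now a vector space over the fractions.
The g_n generate a line in it, and divisibility of D yields suitable d_n one
after the other. Afterwards only the zero ideal J matters for flatness, as the
quotient is divisible. *)
Lemma adjoin_divisible : exists Gr', [/\ graph Gr', locally_flat (dom_graph Gr'),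
  Gr `<=` Gr' & exists2 q, Gr' q & ~ Gr q]%classic.
Proof.
have next (q : G * D) : exists q', exists2 s, ~ m s & Gr (s *: q - r *: q').
  case: q => y d; have [s [h [y' [ms [e he] sy]]]] := nakayama y.
  have [d' rd'] := Ddiv (s *: d - e) r0.
  exists (y', d'), s => //; rewrite -[_ - _]/(_, _) /= sy addrK rd'.
  by rewrite opprB addrC subrK.
have [nxt nxtP] := choice next.
pose p n := iter n nxt (g, 0).
have pS n : exists s a, S s /\ Gr (s *: p n - a *: p n.+1).
  by have [s ms Gs] := nxtP (p n); exists s, r.
have np n : ~ H (p n).1.
  elim: n => [|n IH] => [//|Hp]; apply: IH; have [s ms] := nxtP (p n).
  rewrite -[nxt _]/(p n.+1) => Gs; apply: Hflat.1 (ms) _.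
  rewrite -[s *: _](subrK (r *: (p n.+1).1)); apply: submoduleD => //.
    by exists ((s *: p n - r *: p n.+1).2).
  exact: submoduleZ.
have pfree n a : H (a *: (p n).1) -> a = 0.
  move=> Hap; apply/eqP; apply: contrapT => /negP a0; apply: (np n).
  exact: locally_flat_torsion_free Hflat a0 Hap.
have Asat := adjoin_saturated SM Ssurj (Gr := Gr) (p := p).
have Asub x : H x -> dom_graph (adjoin S Gr p) x.
  by move=> [d xd]; exists d; apply: sub_adjoin.
have Ar x : dom_graph (adjoin S Gr p) (r *: x) -> dom_graph (adjoin S Gr p) x.
  move=> /(adjoin_dom Ssurj)[n [s [a [ms Hs]]]].
  have [t mt Gt] := nxtP (p n); apply/(adjoin_dom Ssurj).
  exists n.+1, (t * s), a; split; first exact: SM.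
  apply: (locally_flat_torsion_free Hflat r0).
  have -> : r *: ((t * s) *: x - a *: (p n.+1).1) =
      t *: (s *: (r *: x) - a *: (p n).1) +
      a *: (t *: (p n).1 - r *: (p n.+1).1).
    rewrite !scalerBr !scalerA addrA [t * a]mulrC subrK.
    by congr (_ *: _ - _ *: _); ring.
  apply: (submoduleD Hsub); apply: (submoduleZ Hsub) => //.
  by exists ((t *: p n - r *: p n.+1).2).
exists (adjoin S Gr p); split; last first.
- exists (g, 0); first exact: (mem_adjoin S1 p Ggr 0).
  by move=> gG; apply: ng; exists 0.
- exact: sub_adjoin.
- split=> [|J a x Jsub Jax]; first exact: Asat.
  have [[c Jc c0]|J0] := pselect (exists2 c, J c & c != 0).
    have [s [h [y [ms Hh sx]]]] := division x c0.
    exists s => //; exists h, (c *: y); split=> //; first exact: Asub.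
    by apply: mem_ideal_mul; rewrite mulrC; apply: (submoduleZ Jsub a).
  have [a0|a0] := eqVneq a 0.
    exists 1 => //; apply: mem_ideal_mul_addr.
      exact: dom_graph_submodule (adjoin_graph S1 SM Sinj Ggr pS pfree).1.
    by apply: mem_ideal_mul; rewrite a0 mulr0; apply: Jsub.1.
  exists 1 => //; rewrite scale1r; apply: mem_ideal_mul_addl.
  have {}Jax : dom_graph (adjoin S Gr p) (a *: x).
    have [h [z [Ah Jz ->]]] := Jax; rewrite (@zero_ideal_mul z) ?addr0//.
    apply: ideal_mul_sub Jz => b Jb; apply/eqP; apply: contrapT => /negP b0.
    by apply: J0; exists b.
  have [k [t [f [mt rt]]]] := power_divides Rmin a0 mr.
  apply: Asat (mt) _; have : dom_graph (adjoin S Gr p) (r ^+ k *: (t *: x)).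
    rewrite scalerA rt -scalerA; apply: submoduleZ => //.
    exact: dom_graph_submodule (adjoin_graph S1 SM Sinj Ggr pS pfree).1.
  by elim: (k) => [|l IH]; rewrite ?expr0 ?scale1r// exprS -scalerA => /Ar.
- exact: adjoin_graph.
Qed.

End Division.
End Step.
End LocallyFlatQuotient.

Lemma local_extension (K G M D : lmodType R) (i : {linear K -> G})
    (e : {linear G -> M}) :
  injective i -> surjective e -> exact_at i e -> flat M ->
  primary D -> divisible D -> extends i D.
Proof.
move=> i_inj e_surj ie Mflat Dprim Ddiv.
apply: (@graph_extension R G D S _ _ _ _ K i (@locally_flat G)) => //.
- exact: max_proper.
- by move=> s t; apply: max_prime.
- by move=> s d; apply: primary_inj.
- by move=> s d; apply: primary_surj.
- split=> [s x ms [t mt [k tk]]|].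
    by exists (t * s); [apply: max_prime | exists k; rewrite -scalerA].
  move=> J a x Jsub [h [z [[s ms [k sh]] Jz ax]]].
  have : ideal_mul J (a *: e (s *: x)).
    have -> : a *: e (s *: x) = e (s *: z).
      rewrite -linearZ scalerA mulrC -scalerA ax scalerDr linearD sh.
      by rewrite (_ : e (i k) = 0) ?add0r//; apply/ie; exists k.
    by apply: ideal_mul_map; apply: (submoduleZ ideal_mul_submodule).
  move=> /(flat_colon Mflat Jsub)/(ideal_mul_lift e_surj)[w Jw ew].
  exists s => //; exists (s *: x - w), w; split=> //; last by rewrite subrK.
  exists 1; first exact: max_proper.
  have [l <-] : exists l, i l = s *: x - w by apply/ie; rewrite linearB ew subrr.
  by exists l; rewrite scale1r.
- move=> F FQ _ _; split=> [s x ms [H FH Hx]|J a x Jsub].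
    by exists H => //; apply: (FQ _ FH).1 Hx.
  move=> [h [z [[H FH Hh] Jz ax]]].
  have [|s ms sx] := (FQ _ FH).2 J a x Jsub; first by exists h, z.
  exists s => //; apply: ideal_mul_add_sub sx => // y Hy.
  by exists H.
move=> Gr Ggr Hflat [g ng].
have [[g' g'H]|mH] := pselect (exists g, ~ ideal_mul_add m (dom_graph Gr) g).
  exact: adjoin_generator g'H.
have [r mr r0] := max_nonzero m.
apply: adjoin_divisible mr r0 _ ng => // y; apply: contrapT => ny.
by apply: mH; exists y.
Qed.

End LocalExtension.

(** * Extension into a torsion module, through its primary components *)

Lemma submod_torsion_free (R : idomainType) (W : lmodType R)
    (Z : submodClosed W) :
  torsion_free W -> torsion_free (submod Z).
Proof.
move=> Wtf r z rz; have rz0 : r *: incl z = 0 by rewrite -linearZ rz linear0.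
have [->|z0] := Wtf _ _ rz0; [by left | right].
by apply: incl_inj; rewrite z0 linear0.
Qed.

Lemma submod_divisible (R : idomainType) (W : lmodType R) (Z : submodClosed W) :
  divisible W -> (forall (c : R) (w : W), c != 0 -> c *: w \in Z -> w \in Z) ->
  divisible (submod Z).
Proof.
move=> Wdiv Zpure c z c0; have [w cw] := Wdiv c (incl z) c0.
have [|y yw] := @incl_surj _ _ Z w.
  by apply: Zpure c0 _; rewrite cw; apply: inclP.
by exists y; apply: incl_inj; rewrite linearZ /= yw.
Qed.

Section PrimaryDecomposition.
Variables (R : idomainType) (Rmin : minimum_condition R).
Variables (D : lmodType R).
Hypothesis Dtors : forall x : D, exists2 c : R, c != 0 & c *: x = 0.

Lemma primary_part_submodule (m : max_ideal R) :
  submodule (fun x : D => forall a, m a -> exists k, a ^+ k *: x = 0).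
Proof.
split=> [a ma|c x y xm ym a ma]; first by exists 0%N; rewrite scaler0.
have [[k kx] [l ly]] := (xm a ma, ym a ma); exists (k + l)%N.
rewrite scalerDr exprD scalerA [_ * c]mulrC -!scalerA.
rewrite [a ^+ k *: (a ^+ l *: x)]scalerA [a ^+ k * _]mulrC -scalerA kx.
by rewrite ly !scaler0 addr0.
Qed.

Definition primary_part (m : max_ideal R) :=
  submod (closed_of (primary_part_submodule m)).
HB.instance Definition _ m := GRing.Lmodule.on (primary_part m).

Lemma primary_partP (m : max_ideal R) : primary m (primary_part m).
Proof.
move=> x a ma; have /closed_ofP/(_ a ma)[k kx] := inclP x.
by exists k; apply: incl_inj; rewrite linearZ /= kx linear0.
Qed.

(** The projection to the component at m is the localization at m: its value at
x is the only m-primary element whose difference with x is killed by an element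
outside m.
It exists because it is e x for the idempotent e modulo an annihilator of x. *)
Lemma primary_projection (m : max_ideal R) :
  exists p : {linear D -> primary_part m},
    forall x, exists2 t, ~ m t & t *: (x - incl (p x)) = 0.
Proof.
pose Gr (q : D * primary_part m) := exists2 t, ~ m t & t *: (q.1 - incl q.2) = 0.
apply: (@linear_of_graph _ _ _ Gr).
- split=> [|a [x y] [x' y'] [t mt tx] [t' mt' tx']].
    by exists 1; [exact: max_proper | rewrite /= [incl _]linear0 subrr scaler0].
  exists (t * t'); first exact: max_prime.
  rewrite /= [incl _]linearP opprD addrACA -scalerBr scalerDr scalerA [_ * a]mulrC.
  rewrite -!scalerA tx' scaler0 addr0 [t *: (t' *: _)]scalerA [t * t']mulrC.
  by rewrite -scalerA tx !scaler0.
- move=> y [t mt]; rewrite /= sub0r scalerN => /eqP; rewrite oppr_eq0 => /eqP ty.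
  apply: (primary_inj (@primary_partP m) mt).
  by apply: incl_inj; rewrite linearZ /= ty linear0.
- move=> x; have [c c0 cx] := Dtors x.
  have [t [e [mt [f tf] eP]]] := local_idempotent Rmin m c0.
  have [|y yx] := @incl_surj _ _ (closed_of (primary_part_submodule m)) (e *: x).
    apply/closed_ofP => a /eP[k [g kg]]; exists k.
    by rewrite scalerA kg -scalerA cx scaler0.
  exists y, t => //=; rewrite yx -[X in X - _]scale1r -scalerBl scalerA tf.
  by rewrite -scalerA cx scaler0.
Qed.

Definition prim (m : max_ideal R) : {linear D -> primary_part m} :=
  projT1 (cid (primary_projection m)).

Lemma primP (m : max_ideal R) x : exists2 t, ~ m t & t *: (x - incl (prim m x)) = 0.
Proof. exact: (projT2 (cid (primary_projection m))). Qed.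

Lemma prim_unique (m : max_ideal R) x (y : primary_part m) t :
  ~ m t -> t *: (x - incl y) = 0 -> prim m x = y.
Proof.
move=> mt ty; have [s ms sx] := primP m x; apply/subr0_eq.
apply: (primary_inj (@primary_partP m) (max_prime ms mt)); apply: incl_inj.
rewrite linear0 linearZ linearB /=.
rewrite (_ : _ - incl y = (x - incl y) - (x - incl (prim m x))); last first.
  by rewrite opprB [RHS]addrC addrA subrK.
rewrite scalerBr -scalerA ty scaler0 [s * t]mulrC -scalerA sx scaler0.
by rewrite subrr.
Qed.

Lemma prim_incl (m : max_ideal R) (y : primary_part m) : prim m (incl y) = y.
Proof.
by apply: (@prim_unique _ _ _ 1); [exact: max_proper | rewrite subrr scaler0].
Qed.

Lemma prim_other (m n : max_ideal R) (y : primary_part n) :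
  m <> n -> prim m (incl y) = 0.
Proof.
move=> mn; have [|a na ma] := @max_separate _ n m; first by move/esym.
have [k ky] := primary_partP y na.
apply: (primary_inj (@primary_partP m) (max_primeX (k := k) ma)).
by rewrite -linearZ -[_ *: incl y]linearZ ky !linear0.
Qed.

Lemma prim_eq0 x : (forall m, prim m x = 0) -> x = 0.
Proof.
move=> x0; apply: contrapT => nx; have [c c0 cx] := Dtors x.
have [v [m mv]] := torsion_max_annihilator Rmin c0 cx nx.
have [|y yv] := @incl_surj _ _ (closed_of (primary_part_submodule m)) (v *: x).
  by apply/closed_ofP => a /mv ax; exists 1%N; rewrite expr1.
apply: (max_proper (m := m)); apply/mv; rewrite scale1r -yv.
by rewrite -(prim_incl y) yv [prim m _]linearZ /= x0 scaler0 linear0.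
Qed.

Lemma primary_part_divisible m : divisible D -> divisible (primary_part m).
Proof.
move=> Ddiv c y c0; have [d cd] := Ddiv c (incl y) c0.
by exists (prim m d); rewrite -linearZ cd prim_incl.
Qed.

(** A family killed by one nonzero c has only finitely many nonzero members, and
is the family of components of their sum. Without listing the maximal ideals
that contain c: among the u for which (1 - u) y comes from D, take a minimal
one; splitting off the component at n replaces u by u (1 - e_n), hence u is a
multiple of u (1 - e_n) modulo c, and u kills y_n, for each n. *)
Lemma prim_glue (c : R) (y : forall m, primary_part m) : c != 0 ->
  (forall m, c *: y m = 0) -> exists d, forall m, prim m d = y m.
Proof.
move=> c0 cy; pose U u := exists d, forall m, prim m d = (1 - u) *: y m.
have U1 : U 1 by exists 0 => m; rewrite linear0 subrr scale0r.
have [u [d du] umin] := Rmin c0 U1; exists d => n; rewrite du.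
have [t [e [nt [f tf] eP]]] := local_idempotent Rmin n c0.
have ey : (1 - e) *: y n = 0.
  apply: (primary_inj (@primary_partP n) nt).
  by rewrite scalerA tf -scalerA cy scaler0.
have [|b [g ug]] := umin (1 - e).
  exists (d + u *: incl (y n)) => m; rewrite linearD linearZ du /=.
  have [->|mn] := pselect (m = n).
    rewrite prim_incl -scalerDl subrK scalerBl.
    by rewrite -scalerA ey scaler0 subr0.
  rewrite (prim_other _ mn) scaler0 addr0.
  have e0 : e *: y m = 0.
    have [|a na ma] := @max_separate _ n m; first by move/esym.
    have [k [h kh]] := eP a na.
    apply: (primary_inj (@primary_partP m) (max_primeX (k := k) ma)).
    by rewrite scalerA kh -scalerA cy scaler0.
  rewrite (_ : 1 - u * (1 - e) = (1 - u) + u * e); last by ring.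
  by rewrite [RHS]scalerDl -scalerA e0 scaler0 addr0.
rewrite scalerBl scale1r ug scalerDl -!scalerA ey cy !scaler0 addr0 subr0.
by [].
Qed.

End PrimaryDecomposition.

Section Extension.
Variables (R : idomainType) (Rmin : minimum_condition R).
Variables (K G M : lmodType R) (i : {linear K -> G}) (e : {linear G -> M}).
Hypotheses (i_inj : injective i) (e_surj : surjective e) (ie : exact_at i e).
Hypotheses (Mflat : flat M) (Gproj : projective G).

Lemma divisible_image (W D : lmodType R) (q : {linear W -> D}) :
  surjective q -> divisible W -> divisible D.
Proof.
move=> q_surj Wdiv c d c0; have [w <-] := q_surj d.
by have [v <-] := Wdiv c w c0; exists (q v); rewrite linearZ.
Qed.

(** Extensions into the components lift to maps G -> W, as G is projective, and
together give a map from G to the product of copies of W indexed by the maximal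
ideals. It sends K to the submodule Z of families whose components come from
one element of D. By [prim_glue] the quotient by Z is torsion-free, so Z is
torsion-free divisible, hence a retract of the product. *)
Lemma torsion_extension (W D : lmodType R) (q : {linear W -> D}) :
    torsion_free W -> divisible W -> surjective q ->
    (forall x : D, exists2 c : R, c != 0 & c *: x = 0) ->
  extends i D.
Proof.
move=> Wtf Wdiv q_surj Dtors f; pose p := prim Rmin Dtors.
have Ddiv := divisible_image q_surj Wdiv.
have [H HP] : {H : max_ideal R -> {linear G -> W} &
    forall m k, p m (q (H m (i k))) = p m (f k)}.
  apply: (@choice _ _ (fun m (H : {linear G -> W}) => forall k,
    p m (q (H (i k))) = p m (f k))) => m.
  have pq_surj : surjective (p m \o q).
    move=> y; have [w wy] := q_surj (incl y).
    by exists w; rewrite /= wy; apply: prim_incl.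
  have [F FP] := local_extension Rmin i_inj e_surj ie Mflat
    (@primary_partP _ _ m) (primary_part_divisible Rmin Dtors Ddiv) (p m \o f).
  have [H HP] := Gproj F pq_surj.
  by exists H => k; rewrite -[LHS]/((p m \o q) (H (i k))) HP FP.
pose WM : lmodType R := max_ideal R -> W.
have Hlin : linear ((fun x m => H m x) : G -> WM).
  by move=> a x y; apply/funext => m; rewrite linearP.
pose Ht := linear_of Hlin.
pose Z (w : WM) := exists d, forall m, p m (q (w m)) = p m d.
have Zsub : submodule Z.
  split=> [|a w w' [d wd] [d' wd']]; first by exists 0 => m; rewrite !linear0.
  by exists (a *: d + d') => m; rewrite !linearP /= -wd -wd'.
have WMtf : torsion_free WM.
  move=> r w rw; have [r0|r0] := eqVneq r 0; [by left | right].
  apply/funext => m; have := congr1 (fun g => g m) rw.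
  by move=> /= /Wtf[/eqP|//]; rewrite (negbTE r0).
have WMdiv : divisible WM.
  move=> c w c0; have [v vP] := choice (fun m => Wdiv c (w m) c0).
  by exists v; apply/funext => m; apply: vP.
have Zpure (c : R) (w : WM) : c != 0 ->
    c *: w \in closed_of Zsub -> w \in closed_of Zsub.
  move=> c0 /closed_ofP[d cw]; apply/closed_ofP.
  have [d' cd] := Ddiv c d c0.
  pose y m := p m (q (w m) - d').
  have [|d'' yd] := prim_glue Rmin Dtors (y := y) c0.
    move=> m; have cwm : p m (q (c *: w m)) = p m d := cw m.
    by rewrite /y -linearZ scalerBr cd [p m _]linearB -cwm [q (c *: _)]linearZ subrr.
  exists (d'' + d') => m; rewrite linearD yd /y linearB /=.
  by rewrite subrK.
have [rho rhoP] := torsion_free_divisible_injective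
  (@incl_inj _ _ (closed_of Zsub)) (submod_torsion_free WMtf)
  (submod_divisible WMdiv Zpure) idfun.
have ev_linear m : linear (fun w : WM => w m) by [].
pose L m : {linear G -> primary_part D m} :=
  p m \o q \o linear_of (ev_linear m) \o @incl _ _ (closed_of Zsub) \o rho \o Ht.
pose Gr (xd : G * D) := forall m, L m xd.1 = p m xd.2.
have Grsub : submodule Gr.
  split=> [m|a [x d] [x' d'] xd xd' m]; first by rewrite !linear0.
  by rewrite [LHS]linearP [RHS]linearP; congr (_ *: _ + _); [apply: xd | apply: xd'].
have Grfun d : Gr (0, d) -> d = 0.
  move=> d0; apply: (prim_eq0 (Rmin := Rmin) (Dtors := Dtors)) => m.
  by rewrite -[LHS]/(p m d) -d0 linear0.
have Grtot x : exists d, Gr (x, d).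
  by have /closed_ofP[d xd] := inclP (rho (Ht x)); exists d.
have [F FP] := linear_of_graph Grsub Grfun Grtot.
exists F => k; apply/subr0_eq/(prim_eq0 (Rmin := Rmin) (Dtors := Dtors)) => m.
rewrite linearB -[LHS]/(p m (F (i k)) - p m (f k)) -(FP (i k)).
have [|z zE] := @incl_surj _ _ (closed_of Zsub) (Ht (i k)).
  by apply/closed_ofP; exists (f k) => l; apply: HP.
rewrite -[L m _]/(p m (q (incl (rho (Ht (i k))) m))) -zE rhoP /= zE.
by rewrite [p m (q _)]HP subrr.
Qed.

(** First extend modulo the torsion of D, where the target is injective, and
lift along W; what remains is a map from K to the torsion of D. *)
Lemma divisible_extension (W D : lmodType R) (q : {linear W -> D}) :
  torsion_free W -> divisible W -> surjective q -> extends i D.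
Proof.
move=> Wtf Wdiv q_surj f.
pose tors (x : D) := exists2 c : R, c != 0 & c *: x = 0.
have tsub : submodule tors.
  split=> [|a x y [c c0 cx] [d d0 dy]].
    by exists 1; rewrite ?oner_eq0 ?scaler0.
  exists (c * d); first by rewrite mulf_neq0.
  rewrite scalerDr -[(c * d) *: y]scalerA dy scaler0 addr0 scalerA.
  by rewrite (_ : c * d * a = d * a * c); [rewrite -scalerA cx scaler0 | ring].
pose pi : {linear D -> quotmod (closed_of tsub)} := quotmod_pi (closed_of tsub).
have pi_surj : surjective pi by move=> u; exists (repr u); apply: quotmod_reprK.
have pi0 x : pi x = 0 <-> tors x.
  by rewrite -(linear0 pi) /pi quotmod_piP subr0; apply: closed_ofP.
have Utf : torsion_free (quotmod (closed_of tsub)).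
  move=> r u; have [x <-] := pi_surj u; rewrite -linearZ => /pi0[c c0 cx].
  have [->|r0] := eqVneq r 0; [by left | right]; apply/pi0.
  by exists (c * r); rewrite ?mulf_neq0// -scalerA.
have Udiv := divisible_image pi_surj (divisible_image q_surj Wdiv).
have [F2 F2P] := torsion_free_divisible_injective i_inj Utf Udiv (pi \o f).
have piq_surj : surjective (pi \o q).
  by move=> u; have [x <-] := pi_surj u; have [w <-] := q_surj x; exists w.
have [H HP] := Gproj F2 piq_surj.
have [f' f'P] : exists f' : {linear K -> submod (closed_of tsub)},
    forall k, incl (f' k) = f k - q (H (i k)).
  apply: (@corestriction _ _ _ (closed_of tsub) (f \- (q \o H \o i))) => k.
  apply/closed_ofP/pi0; rewrite linearB.
  by rewrite -[pi (q _)]/((pi \o q) (H (i k))) HP F2P subrr.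
have wsub : submodule (fun w => tors (q w)).
  split=> [|a x y xt yt]; first by rewrite linear0; apply: tsub.1.
  by rewrite linearP; apply: tsub.2.
have [qt qtP] : exists qt : {linear submod (closed_of wsub) ->
    submod (closed_of tsub)}, forall w, incl (qt w) = q (incl w).
  apply: (@corestriction _ _ _ (closed_of tsub)
    (q \o @incl _ _ (closed_of wsub))) => w.
  by have /closed_ofP wt := inclP w; apply/closed_ofP.
have [F FP] : exists F : {linear G -> submod (closed_of tsub)},
    forall k, F (i k) = f' k.
  apply: (torsion_extension (q := qt)).
  - exact: submod_torsion_free.
  - apply: submod_divisible => // c w c0 /closed_ofP[d d0 dw].
    apply/closed_ofP; exists (d * c); first exact: mulf_neq0.
    by rewrite -scalerA -[c *: q w]linearZ.
  - move=> x; have [w wx] := q_surj (incl x).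
    have [|v vw] := @incl_surj _ _ (closed_of wsub) w.
      by apply/closed_ofP; rewrite wx; apply/closed_ofP/inclP.
    by exists v; apply: incl_inj; rewrite qtP vw.
  move=> x; have /closed_ofP[c c0 cx] := inclP x.
  by exists c => //; apply: incl_inj; rewrite linearZ /= cx linear0.
exists ((q \o H) \+ (@incl _ _ (closed_of tsub) \o F)) => k /=.
by rewrite FP f'P addrC subrK.
Qed.

End Extension.

(** * Flat modules have projective dimension at most 1 *)

Section FractionFree.
Variables (R : idomainType) (T : choiceType).

(** A vector space over the fractions, regarded as an R-module. *)
Definition fraction_free := {freeg T / {fraction R}}.
HB.instance Definition _ := GRing.Zmodule.on fraction_free.

Definition fraction_scale (r : R) (x : fraction_free) : fraction_free :=
  (tofrac r : {fraction R}) *: (x : {freeg T / {fraction R}}).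

Fact fraction_scaleA a b x :
  fraction_scale a (fraction_scale b x) = fraction_scale (a * b) x.
Proof. by rewrite /fraction_scale scalerA tofracM. Qed.
Fact fraction_scale1 : left_id 1 fraction_scale.
Proof. by move=> x; rewrite /fraction_scale tofrac1 scale1r. Qed.
Fact fraction_scaleDr : right_distributive fraction_scale +%R.
Proof. by move=> a x y; apply: scalerDr. Qed.
Fact fraction_scaleDl x : {morph fraction_scale^~ x : a b / a + b}.
Proof. by move=> a b; rewrite /fraction_scale tofracD scalerDl. Qed.

HB.instance Definition _ := GRing.Zmodule_isLmodule.Build R fraction_free
  fraction_scaleA fraction_scale1 fraction_scaleDr fraction_scaleDl.

Lemma fraction_free_torsion_free : torsion_free fraction_free.
Proof.
move=> r x /eqP; rewrite -[r *: x]/(_ *: (x : {freeg T / {fraction R}})).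
rewrite scaler_eq0 tofrac_eq0 => /orP[/eqP|/eqP]; by [left | right].
Qed.

Lemma fraction_free_divisible : divisible fraction_free.
Proof.
move=> c x c0; exists ((tofrac c)^-1 *: (x : {freeg T / {fraction R}})).
rewrite -[LHS]/(_ *: (_ *: (x : {freeg T / {fraction R}}))) scalerA.
by rewrite divff ?scale1r// tofrac_eq0.
Qed.

Lemma free_embedding :
  exists j : {linear {freeg T / R} -> fraction_free}, injective j.
Proof.
pose j : {linear {freeg T / R} -> fraction_free} :=
  fglift (fun t => << t >> : fraction_free).
have jE x t : coeff t (j x : {freeg T / {fraction R}}) = tofrac (coeff t x).
  elim/freeg_ind_dom0: x => [|k u D _ _ IH].
    by rewrite linear0 !coeff0 tofrac0.
  rewrite linearD !coeffD tofracD IH /j /= liftU coeffU coeffZ coeffU mul1r tofracM.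
  by congr (_ * _ + _); case: eqP; rewrite ?tofrac1 ?tofrac0.
exists j; apply: raddf_inj => x jx; apply/eqP/freeg_eqP => t.
by apply/eqP; rewrite -tofrac_eq -jE jx !coeff0 tofrac0.
Qed.

End FractionFree.

Lemma projective_retract (R : nzRingType) (P Q : lmodType R) (s : {linear Q -> P})
    (e : {linear P -> Q}) : projective P -> (forall x, e (s x) = x) -> projective Q.
Proof.
move=> Pproj es A B g f g_surj; have [h hP] := Pproj _ _ g (f \o e) g_surj.
by exists (h \o s) => x; rewrite /= hP /= es.
Qed.

(** With A free on K and W its space of fractions, D = W / ker (A -> K) contains
A / ker (A -> K) = K. The inclusion of K extends to G -> D and lifts to
phi : G -> W; an element of K is sent by phi into A + ker (A -> K) = A, and
this splits A -> K. *)
Lemma flat_kernel_projective (R : idomainType) (Rmin : minimum_condition R)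
    (K G M : lmodType R) (i : {linear K -> G}) (e : {linear G -> M}) :
  injective i -> surjective e -> exact_at i e -> flat M -> projective G ->
  projective K.
Proof.
move=> i_inj e_surj ie Mflat Gproj; pose A : lmodType R := {freeg K / R}.
have [eps eps_surj] : exists eps : {linear A -> K}, surjective eps.
  exact: free_cover.
have [j j_inj] := free_embedding R K.
have Nsub : submodule (fun w => exists2 a, eps a = 0 & j a = w).
  split=> [|c _ _ [a a0 <-] [b b0 <-]]; first by exists 0; rewrite linear0.
  by exists (c *: a + b); rewrite linearP // a0 b0 scaler0 addr0.
pose pi : {linear fraction_free R K -> quotmod (closed_of Nsub)} :=
  quotmod_pi (closed_of Nsub).
have piP w w' : pi w = pi w' <-> exists2 a, eps a = 0 & j a = w - w'.
  by rewrite /pi quotmod_piP; apply: closed_ofP.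
have pi_surj : surjective pi by move=> u; exists (repr u); apply: quotmod_reprK.
have [f fP] : exists f : {linear K -> quotmod (closed_of Nsub)},
    forall k, exists2 a, eps a = k & pi (j a) = f k.
  apply: (@linear_of_graph _ _ _
    (fun p : K * quotmod (closed_of Nsub) =>
      exists2 a, eps a = p.1 & pi (j a) = p.2)).
  - split=> [|c [k u] [l v] [a /= <- <-] [b /= <- <-]].
      by exists 0; rewrite !linear0.
    by exists (c *: a + b); rewrite !linearP.
  - move=> u [a /= a0 <-]; rewrite -(linear0 pi); apply/piP.
    by exists a; rewrite ?subr0.
  - by move=> k; have [a ak] := eps_surj k; exists (pi (j a)), a.
have [F FP] := divisible_extension Rmin i_inj e_surj ie Mflat Gproj
  (@fraction_free_torsion_free R K) (@fraction_free_divisible R K) pi_surj f.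
have [phi phiP] := Gproj _ _ pi F pi_surj.
have [s sP] : exists s : {linear K -> A},
    forall k, eps (s k) = k /\ j (s k) = phi (i k).
  apply: (@linear_of_graph _ _ _
    (fun p : K * A => eps p.2 = p.1 /\ j p.2 = phi (i p.1))).
  - split=> [|c [k a] [l b] [/= ak ja] [/= bl jb]]; first by rewrite /= !linear0.
    by rewrite /= !linearP ak bl ja jb.
  - by move=> a [_]; rewrite /= !linear0 -(linear0 j) => /j_inj.
  - move=> k; have [a ak aE] := fP k.
    have /piP[b b0 jb] : pi (phi (i k)) = pi (j a) by rewrite phiP FP aE.
    by exists (b + a); rewrite /= !linearD b0 ak add0r jb subrK.
by apply: (@projective_retract _ A _ s eps) => [|k];
  [apply: free_projective | case: (sP k)].
Qed.

Lemma flat_proj_dim_le1 (R : idomainType) (M : lmodType R) :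
  minimum_condition R -> flat M -> proj_dim_le 1 M.
Proof.
move=> Rmin Mflat; pose G : lmodType R := {freeg M / R}.
have [e e_surj] : exists e : {linear G -> M}, surjective e by exact: free_cover.
pose S := closed_of (submodule_kernel e).
pose K : lmodType R := submod S.
have ie : exact_at (@incl _ _ S) e.
  move=> x; split=> [ex|[y <-]]; last by have /closed_ofP := inclP y.
  by apply: incl_surj; apply/closed_ofP.
pose O : lmodType R := 'rV[R]_0.
have O0 (x : O) : x = 0 by apply: thinmx0.
pose P n : lmodType R := match n with 0 => G | 1 => K | _ => O end.
pose d n : {linear P n.+1 -> P n} :=
  match n with 0 => @incl _ _ S | _ => \0 end.
exists P, d, e; split=> //.
- have Oproj : projective O.
    by move=> A B g f _; exists \0 => x; rewrite [x]O0 !linear0.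
  case=> [|[|n]] //=; first exact: free_projective.
  apply: (flat_kernel_projective Rmin (@incl_inj _ _ S) e_surj ie Mflat).
  exact: free_projective.
- by case=> [|[|n]].
case=> [|n] y.
  split=> [y0|[x <-]]; last by rewrite linear0.
  by exists 0; apply: incl_inj; rewrite [RHS]y0 linear0.
split=> [_|[x <-]] //; exists 0; rewrite linear0.
by case: n y => [|n] y; rewrite [RHS]O0.
Qed.

(** * Torsion-free modules of weak dimension at most 1 are flat *)

Section TensorRight.
Variables (R : comNzRingType) (X : lmodType R).

Lemma tensor_mapr_bilinear (P Q : lmodType R) (d : {linear P -> Q}) :
  bilinear_map (fun (x : X) p => pure x (d p)).
Proof.
split=> [p a x y|x a p q] /=; first by rewrite pureDl pureZl.
by rewrite linearP pureDr pureZr.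
Qed.

Definition tensor_mapr (P Q : lmodType R) (d : {linear P -> Q}) :
  {linear tensor X P -> tensor X Q} := lift_linear (tensor_mapr_bilinear d).

Lemma tensor_mapr_pure (P Q : lmodType R) (d : {linear P -> Q}) x p :
  tensor_mapr d (pure x p) = pure x (d p).
Proof. exact: lift_linearE. Qed.

Lemma tensor_mapr_surj (P Q : lmodType R) (e : {linear P -> Q}) :
  surjective e -> surjective (tensor_mapr e).
Proof.
move=> e_surj; apply: tensor_ind => [x q|_ _ [z <-] [z' <-]|r _ [z <-]].
- by have [p <-] := e_surj q; exists (pure x p); rewrite tensor_mapr_pure.
- by exists (z + z'); rewrite linearD.
- by exists (r *: z); rewrite linearZ.
Qed.

(** The inverse of the map from the cokernel to X (x) M is built by lifting
elements of M to P0, which is harmless modulo the image of X (x) P1. *)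
Lemma tensor_mapr_exact (P1 P0 M : lmodType R) (d : {linear P1 -> P0})
    (e : {linear P0 -> M}) :
  surjective e -> exact_at d e ->
  forall z, tensor_mapr e z = 0 -> exists w, tensor_mapr d w = z.
Proof.
move=> e_surj de; have [s sP] := choice e_surj.
have Isub := submodule_image (tensor_mapr d).
pose pi : {linear tensor X P0 -> quotmod (closed_of Isub)} :=
  quotmod_pi (closed_of Isub).
have piP z z' : pi z = pi z' <-> exists w, tensor_mapr d w = z - z'.
  by rewrite /pi quotmod_piP; apply: closed_ofP.
have pi_pure x p p' : e p = e p' -> pi (pure x p) = pi (pure x p').
  move=> pp'; have /de[q qp] : e (p - p') = 0 by rewrite linearB pp' subrr.
  apply/piP; exists (pure x q); rewrite tensor_mapr_pure qp pureDr.
  by rewrite -scaleN1r pureZr scaleN1r.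
have hP : bilinear_map (fun x m => pi (pure x (s m))).
  split=> [m a x y|x a m n] /=; first by rewrite pureDl pureZl linearP.
  rewrite -linearP -pureZr -pureDr; apply: pi_pure.
  by rewrite sP linearP !sP.
move=> z z0; have [] : pi z = lift_linear hP (tensor_mapr e z).
  pose l : {linear tensor X P0 -> quotmod (closed_of Isub)} :=
    lift_linear hP \o tensor_mapr e.
  suff : pi =1 l by apply.
  apply: tensor_ext => x p.
  rewrite -[l _]/(lift_linear hP (tensor_mapr e (pure x p))).
  by rewrite tensor_mapr_pure lift_linearE; apply: pi_pure; rewrite sP.
rewrite z0 linear0 -(linear0 pi) => /piP; rewrite subr0.
exact.
Qed.

(** The image of Y (x) P in X (x) P. *)
Definition tensor_span (P : lmodType R) (Y : X -> Prop) (z : tensor X P) : Prop :=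
  z \in span (fun t => exists y p, Y y /\ t = pure y p).

Lemma tensor_span_submodule (P : lmodType R) (Y : X -> Prop) :
  submodule (@tensor_span P Y).
Proof.
have [s0 sP] :=
  span_submod_closed (fun t : tensor X P => exists y p, Y y /\ t = pure y p).
by split=> [//|a x y Yx Yy]; apply: sP.
Qed.

Lemma mem_tensor_span (P : lmodType R) (Y : X -> Prop) y (p : P) :
  Y y -> tensor_span Y (pure y p).
Proof. by move=> Yy; apply: mem_span; exists y, p. Qed.

Lemma tensor_span_ind (P : lmodType R) (Y : X -> Prop)
    (N : tensor X P -> Prop) : submodule N ->
  (forall y p, Y y -> N (pure y p)) -> forall z, tensor_span Y z -> N z.
Proof.
move=> Nsub YN z /asboolP/(_ (closed_of Nsub)) zN; apply/closed_ofP/zN.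
by move=> _ [y [p [Yy ->]]]; apply/closed_ofP/YN.
Qed.

Lemma tensor_quotient_kernel (P : lmodType R) (S : submodClosed X) (z : tensor X P) :
  tensor_map (quotmod_pi S) z = 0 -> tensor_span (fun x => x \in S) z.
Proof.
have Isub := tensor_span_submodule P (fun x => x \in S).
pose pi : {linear tensor X P -> quotmod (closed_of Isub)} :=
  quotmod_pi (closed_of Isub).
have piP u v : pi u = pi v <-> tensor_span (fun x => x \in S) (u - v).
  by rewrite /pi quotmod_piP; apply: closed_ofP.
have pi_pure x x' p :
    quotmod_pi S x = quotmod_pi S x' -> pi (pure x p) = pi (pure x' p).
  move=> /quotmod_piP xx'; apply/piP.
  rewrite -[- _]scaleN1r -pureZl scaleN1r -pureDl.
  exact: mem_tensor_span.
have hP : bilinear_map (fun (u : quotmod S) p => pi (pure (repr u) p)).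
  split=> [p a u v|u a p q] /=; last by rewrite pureDr pureZr linearP.
  rewrite -linearP -pureZl -pureDl; apply: pi_pure.
  transitivity (a *: u + v); first exact: quotmod_reprK.
  rewrite linearP; congr (_ *: _ + _); apply/esym; exact: quotmod_reprK.
move=> z0; have : pi z = lift_linear hP (tensor_map (quotmod_pi S) z).
  pose l : {linear tensor X P -> quotmod (closed_of Isub)} :=
    lift_linear hP \o tensor_map (quotmod_pi S) (M := P).
  suff : pi =1 l by apply.
  apply: tensor_ext => x p.
  rewrite -[l _]/(lift_linear hP (tensor_map (quotmod_pi S) (pure x p))).
  by rewrite tensor_map_pure lift_linearE; apply: pi_pure; rewrite quotmod_reprK.
by rewrite z0 linear0 -(linear0 pi) => /piP; rewrite subr0.
Qed.

Lemma tensor_mapr_eq0 (P Q N : lmodType R) (d : {linear P -> Q})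
    (e : {linear Q -> N}) :
  (forall p, e (d p) = 0) -> forall z, tensor_mapr e (tensor_mapr d z) = 0.
Proof.
move=> ed; apply: tensor_ind => [x p|u v u0 v0|r u u0].
- by rewrite !tensor_mapr_pure ed pure0r.
- by rewrite !linearD u0 v0 addr0.
- by rewrite -[RHS](scaler0 _ r) -u0 !linearZ.
Qed.

End TensorRight.

Lemma tensor_map_mapr (R : comNzRingType) (A B P Q : lmodType R)
    (f : {linear A -> B}) (d : {linear P -> Q}) (z : tensor A P) :
  tensor_map f (tensor_mapr A d z) = tensor_mapr B d (tensor_map f z).
Proof.
move: z; apply: (@tensor_ind R A P (fun z =>
    tensor_map f (tensor_mapr A d z) = tensor_mapr B d (tensor_map f z)))
  => [a p|u v IHu IHv|r u IHu].
- by rewrite tensor_mapr_pure !tensor_map_pure tensor_mapr_pure.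
- by rewrite !linearD; congr (_ + _).
- by rewrite !linearZ; congr (_ *: _).
Qed.

Section WeakDimension.
Variables (R : idomainType) (Rmin : minimum_condition R).
Variables (P1 P0 M : lmodType R) (d : {linear P1 -> P0}) (e : {linear P0 -> M}).
Hypotheses (P1flat : flat P1) (P0flat : flat P0) (Mtf : torsion_free M).
Hypotheses (d_inj : injective d) (e_surj : surjective e) (de : exact_at d e).

(** The injectivity of (R / m) (x) P1 -> (R / m) (x) P0. Take u whose annihilator
modulo r is m. As u d p is in r P0 and M is torsion-free, u p is in r P1; then p
is in (r R : u) P1 = m P1 by flatness of P1. *)
Lemma maximal_pure (m : max_ideal R) p : ideal_mul m (d p) -> ideal_mul m p.
Proof.
have [r mr r0] := max_nonzero m; have [u uP] := max_annihilator Rmin r0 mr.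
have uq y : ideal_mul m y -> exists q : P0, u *: y = r *: q.
  apply: (@ideal_mul_ind _ _ _ (fun y => exists q : P0, u *: y = r *: q))
    => [|j x /uP[f uj]].
    split=> [|a v w [q yq] [q' zq']]; first by exists 0; rewrite !scaler0.
    exists (a *: q + q').
    by rewrite !scalerDr zq' scalerA mulrC -scalerA yq !scalerA [a * r]mulrC.
  by exists (f *: x); rewrite !scalerA uj [r * f]mulrC.
move=> /uq[q dq]; have : e (r *: q) = 0.
  by rewrite -dq linearZ /= (_ : e (d p) = 0) ?scaler0//; apply/de; exists p.
rewrite linearZ => /Mtf[/eqP|/de[p' p'q]]; first by rewrite (negbTE r0).
have up : u *: p = r *: p' by apply: d_inj; rewrite !linearZ /= p'q.
have Jsub : submodule (V := R^o) (fun x : R => exists f, x = f * r).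
  split=> [|a _ _ [f ->] [g ->]]; first by exists 0; rewrite mul0r.
  by exists (a * f + g); rewrite -[a *: _]/(a * _); ring.
have /(flat_colon P1flat Jsub) :
    ideal_mul (fun x : R => exists f, x = f * r) (u *: p).
  by rewrite up; apply: mem_ideal_mul; exists 1; rewrite mul1r.
by apply: ideal_mul_sub => b [f bu]; apply/uP; exists f; rewrite mulrC.
Qed.

Lemma cyclic_tensor_eq0 (X : lmodType R) (y : X) p :
    (forall a, a *: y = 0 -> a = 0) \/
    (exists m : max_ideal R, forall a, m a <-> a *: y = 0) ->
  pure y (d p) = 0 -> pure y p = 0.
Proof.
move=> yP /(flat_pure_eq0 P0flat) ydp; case: yP => [y0|[m mP]].
  suff -> : p = 0 by apply: pure0r.
  apply: d_inj; rewrite linear0.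
  by apply: (@zero_ideal_mul R); apply: ideal_mul_sub ydp.
have : ideal_mul m p.
  by apply: maximal_pure; apply: ideal_mul_sub ydp => a /mP.
apply: (@ideal_mul_ind _ _ _ (fun p => pure y p = 0)) => [|j x /mP jy].
  split=> [|a u v u0 v0]; first exact: pure0r.
  by rewrite pureDr pureZr u0 v0 scaler0 addr0.
by rewrite pureZr -pureZl jy pure0l.
Qed.

(** Let z be a nonzero element of the kernel, and Y maximal such that z is not
in the image of Y (x) P1, that is, z does not vanish in (X / Y) (x) P1. There, z
comes from every nonzero submodule of X / Y, in particular from a cyclic one
with annihilator 0 or maximal, where [cyclic_tensor_eq0] shows that it is 0. *)
Lemma tensor_mapr_inj (X : lmodType R) : injective (tensor_mapr X d).
Proof.
apply: raddf_inj => z dz; apply: contrapT => nz.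
pose P (Y : set X) := submodule Y /\ ~ tensor_span Y z.
have Pzero : P (fun x => x = 0).
  split; first by split=> // a x y -> ->; rewrite scaler0 addr0.
  move=> z0; apply: nz; move: z0.
  apply: (@tensor_span_ind _ _ _ _ (fun z => z = 0)) => [|y p ->].
    2: exact: pure0l.
  by split=> // a x y -> ->; rewrite scaler0 addr0.
have [F FP Ftot [A FA]|Y [_ [Ysub nYz] Ymax]] := Zorn_above Pzero.
  have dir Y Y' : F Y -> F Y' ->
      exists W, [/\ F W, (Y `<=` W)%classic & (Y' `<=` W)%classic].
    move=> FY FY'; have [YY'|Y'Y] := Ftot _ _ FY FY'; [exists Y' | exists Y].
      by split=> // x.
    by split=> // x.
  split.
    split=> [|a x y [Y FY Yx] [Y' FY' Y'y]].
      by exists A => //; have [[A0 _] _] := FP _ FA.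
    have [W [FW YW Y'W]] := dir _ _ FY FY'; exists W => //.
    by have [[_ Wsub] _] := FP _ FW; apply: Wsub; [apply: YW | apply: Y'W].
  move=> Fz; suff [Y FY Yz] : exists2 Y, F Y & tensor_span Y z.
    by have [_] := FP _ FY.
  have mono (Y W : set X) (t : tensor X P1) :
      (Y `<=` W)%classic -> tensor_span Y t -> tensor_span W t.
    move=> YW; apply: (@tensor_span_ind _ _ _ _ (tensor_span W)) => [|y p Yy].
      exact: tensor_span_submodule.
    exact/mem_tensor_span/YW.
  move: z Fz {dz nz P Pzero FP}.
  apply: (@tensor_span_ind _ _ _ _ (fun z => exists2 Y, F Y & tensor_span Y z)).
    split=> [|a x y [Y FY Yx] [Y' FY' Y'y]].
      by exists A => //; apply: submodule0 (tensor_span_submodule _ _).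
    have [W [FW YW Y'W]] := dir _ _ FY FY'; exists W => //.
    by apply: (tensor_span_submodule _ _).2; [apply: mono Yx | apply: mono Y'y].
  by move=> y p [Y FY Yy]; exists Y => //; apply: mem_tensor_span.
pose pi : {linear X -> quotmod (closed_of Ysub)} := quotmod_pi (closed_of Ysub).
have piP x : pi x = 0 <-> Y x.
  by rewrite -(linear0 pi) /pi quotmod_piP subr0; apply: closed_ofP.
have piz : tensor_map pi z <> 0.
  move=> /tensor_quotient_kernel Yz; apply: nYz; move: z Yz {dz nz P Pzero Ymax}.
  apply: (@tensor_span_ind _ _ _ _ (tensor_span Y)) => [|y p /closed_ofP Yy].
    exact: tensor_span_submodule.
  exact: mem_tensor_span.
have dpiz : tensor_mapr _ d (tensor_map pi z) = 0.
  by rewrite -tensor_map_mapr dz linear0.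
have [y0 [y0_n0 y0P]] : exists y : quotmod (closed_of Ysub), y <> 0 /\
    ((forall a, a *: y = 0 -> a = 0) \/
     (exists m : max_ideal R, forall a, m a <-> a *: y = 0)).
  have [x nYx] : exists x, ~ Y x.
    apply: contrapT => nx; apply: nYz; have YT x : Y x.
      by apply: contrapT => nYx; apply: nx; exists x.
    suff : forall w : tensor X P1, tensor_span Y w by apply.
    apply: (@tensor_ind R X P1 (tensor_span Y)) => [v p|u v Yu Yv|r u Yu].
    - exact: mem_tensor_span.
    - exact: (submoduleD (tensor_span_submodule _ _)).
    - exact: (submoduleZ (tensor_span_submodule _ _)).
  have pix : pi x <> 0 by move=> /piP.
  have [[c c0 cx]|nc] := pselect (exists2 c, c != 0 & c *: pi x = 0).
    have [v [m mP]] := torsion_max_annihilator Rmin c0 cx pix.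
    exists (v *: pi x); split; last by right; exists m.
    move=> vx; apply: (max_proper (m := m)); apply/mP.
    by rewrite vx scaler0.
  exists (pi x); split=> //; left=> a ax; apply/eqP; apply: contrapT => /negP a0.
  by apply: nc; exists a.
pose y := repr y0; have yE : pi y = y0 by apply: quotmod_reprK.
pose Y' x := exists u r, Y u /\ x = u + r *: y.
have Y'sub : submodule Y'.
  split=> [|a _ _ [u [r [Yu ->]]] [v [t [Yv ->]]]].
    by exists 0, 0; rewrite scale0r addr0; split=> //; apply: submodule0.
  exists (a *: u + v), (a * r + t); split; first exact: Ysub.2.
  by rewrite scalerDl scalerDr scalerA addrACA.
have Y'z : tensor_span Y' z.
  apply: contrapT => nY'z; have : Y y.
    apply: (Ymax Y') => //; first by move=> u Yu; exists u, 0; rewrite scale0r addr0.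
    by exists 0, 1; rewrite scale1r add0r; split=> //; apply: submodule0.
  by move=> /piP; rewrite yE.
have [p zp] : exists p, tensor_map pi z = pure y0 p.
  move: Y'z; apply: (@tensor_span_ind _ _ _ _
      (fun z => exists p, tensor_map pi z = pure y0 p)).
    split=> [|a u v [p up] [q vq]].
      by exists 0; rewrite linear0 pure0r.
    by exists (a *: p + q); rewrite linearP /= up vq pureDr pureZr.
  move=> _ p [u [r [Yu ->]]]; exists (r *: p).
  rewrite tensor_map_pure linearD linearZ yE.
  by have /piP -> := Yu; rewrite add0r pureZl pureZr.
apply: piz; rewrite zp; apply: cyclic_tensor_eq0 => //.
by rewrite -tensor_mapr_pure -zp.
Qed.

(** The kernel of A (x) M -> B (x) M is, by the snake lemma, controlled by that of
(B / A) (x) P1 -> (B / A) (x) P0, which is zero. *)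
Lemma two_term_resolution_flat : flat M.
Proof.
move=> A B f f_inj; apply: raddf_inj => z fz.
have [z0 z0E] := tensor_mapr_surj e_surj z.
have [w dw] : exists w, tensor_mapr B d w = tensor_map f z0.
  apply: (tensor_mapr_exact e_surj de).
  by rewrite -tensor_map_mapr z0E.
pose pi : {linear B -> quotmod (closed_of (submodule_image f))} :=
  quotmod_pi (closed_of (submodule_image f)).
have pif a : pi (f a) = 0.
  rewrite -(linear0 pi); apply/quotmod_piP/closed_ofP.
  by exists a; rewrite subr0.
have piw : tensor_map pi w = 0.
  apply: tensor_mapr_inj; rewrite linear0 -tensor_map_mapr dw.
  move: z0 {z0E dw}; apply: (@tensor_ind R A P0
      (fun z0 => tensor_map pi (tensor_map f z0) = 0)) => [a p|u v u0 v0|r u u0].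
  - by rewrite !tensor_map_pure pif pure0l.
  - by rewrite -[RHS]addr0 -{1}u0 -v0 !linearD.
  - by rewrite -[RHS](scaler0 _ r) -u0 !linearZ.
have [w' w'E] : exists w', tensor_map f w' = w.
  have := tensor_quotient_kernel piw.
  apply: (@tensor_span_ind _ _ _ _ (fun w => exists w', tensor_map f w' = w)).
    exact: (submodule_image (tensor_map f (M := P1))).
  by move=> y p /closed_ofP[a <-]; exists (pure a p); rewrite tensor_map_pure.
have z0d : z0 = tensor_mapr A d w'.
  by apply: (P0flat f_inj); rewrite tensor_map_mapr w'E dw.
rewrite -z0E z0d; apply: (tensor_mapr_eq0 (d := d)) => p.
by apply/de; exists p.
Qed.

End WeakDimension.

(** * The theorem *)

Lemma proj_dim_weak_dim (R : comNzRingType) (n : nat) (M : lmodType R) :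
  proj_dim_le n M -> weak_dim_le n M.
Proof.
move=> [P [d [e [Pproj P0 e_surj de dd]]]]; exists P, d, e; split=> // i.
exact: projective_flat.
Qed.

Lemma torsion_free_weak_dim_le1_flat (R : idomainType) (M : lmodType R) :
  minimum_condition R -> torsion_free M -> weak_dim_le 1 M -> flat M.
Proof.
move=> Rmin Mtf [P [d [e [Pflat P0 e_surj de dd]]]].
apply: (two_term_resolution_flat Rmin (Pflat 1%N) (Pflat 0%N) Mtf (d := d 0%N)) e_surj de.
(* d 0 is injective because its kernel is the image of P 2 = 0. *)
apply: raddf_inj => x /(dd 0%N)[y <-].
by rewrite (P0 2%N isT y) linear0.
Qed.

Theorem proposition3p4 (R : idomainType)
    (R_apd : almost_perfect_domain R)
    (R_neq_Q : exists q : {fraction R}, forall r : R, q <> tofrac r)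
    (M : lmodType R) :
  (flat M <-> torsion_free M /\ proj_dim_le 1 M) /\
  (flat M <-> torsion_free M /\ weak_dim_le 1 M).
Proof.
have Rmin := apd_minimum R_apd.
have flat_pd : flat M -> torsion_free M /\ proj_dim_le 1 M.
  by move=> Mflat; split; [apply: flat_torsion_free | apply: flat_proj_dim_le1].
have wd_flat : torsion_free M /\ weak_dim_le 1 M -> flat M.
  by case; apply: torsion_free_weak_dim_le1_flat.
split; split=> //.
- by move=> [Mtf /proj_dim_weak_dim Mwd]; apply: wd_flat.
- by move=> /flat_pd[Mtf /proj_dim_weak_dim].
Qed.
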